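(* For a finite-dimensional continuous left $W$-module $(V,\rho)$, let $\mathcal D(V)$ be the difference module over $\mathbf k(s)$ defined by $$U(s+1)=\rho(a_W(s))\,U(s),\qquad a_W(s)=1+\sum_{n\ge1}\frac{w_n}{(s+1)^n}.$$ This assignment is an exact faithful tensor functor (from finite-dimensional continuous left $W$-modules to difference modules over $\mathbf k(s)$), where tensor products of $W$-modules are defined using $\Delta_*$.
   Context: $\mathbf k$ is an algebraically closed field of characteristic zero; $\mathbf k(s)$ carries the automorphism $\sigma(s)=s+1$. $W=\mathbf k\langle\!\langle w_1,w_2,\ldots\rangle\!\rangle$ is the noncommutative power series algebra completed with respect to the weight $\operatorname{wt}(w_n)=n$, with coproduct $\Delta_*(w_n)=\sum_{i=0}^nw_i\otimes w_{n-i}$, $w_0=1$. A finite-dimensional $W$-module is continuous if all terms of sufficiently large weight act by zero; hence $\rho(a_W(s))$ is a finite sum with entries in $\mathbf k(s)$. A difference module over $\mathbf k(s)$ is a finite-dimensional $\mathbf k(s)$-vector space with a $\sigma$-semilinear bijection; $\mathcal D(V)$ has underlying space $\mathbf k(s)\otimes V$ with the semilinear bijection $U\mapsto\rho(a_W(s))^{-1}\sigma(U)$, whose fixed vectors are the solutions of the displayed system. Tensor products of difference modules are over $\mathbf k(s)$ with the tensor product of the semilinear maps. A module morphism $\varphi$ is sent to its extension of scalars $\mathrm{id}_{\mathbf k(s)}\otimes\varphi$. *)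

(* Defs.v *)
From HB Require Import structures.
From mathcomp Require Import all_boot all_order all_algebra.
From mathcomp Require Import boolp classical_sets functions cardinality fsbigop.

Set Implicit Arguments.
Unset Strict Implicit.
Unset Printing Implicit Defensive.

Import GRing.Theory.
Local Open Scope ring_scope.

(* Coordinates with respect to the library's basis vbasis {:U}. *)
Section Basis.
Variables (F : fieldType) (U : vectType F).
Definition basis_vec (i : 'I_(\dim {:U})) : U := (vbasis {:U})`_i.
Definition coef (i : 'I_(\dim {:U})) (u : U) : F := coord (vbasis {:U}) i u.

Lemma co_scalar i : scalar (coef i).
Proof. by move=> a x y; rewrite /coef linearP. Qed.
HB.instance Definition _ i := GRing.isSemilinear.Build F U F _ (coef i)
  (GRing.semilinear_linear (co_scalar i)).

Lemma co_sum u : \sum_i coef i u *: basis_vec i = u.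
Proof. exact/esym/(coord_vbasis (memvf u)). Qed.

Lemma co_bv i j : coef i (basis_vec j) = (i == j)%:R.
Proof. by rewrite /coef /basis_vec coord_free ?(basis_free (vbasisP _)) // eq_sym. Qed.

Lemma co_inj u v : (forall i, coef i u = coef i v) -> u = v.
Proof. by move=> h; rewrite -(co_sum u) -(co_sum v); apply: eq_bigr => i _; rewrite h. Qed.

Lemma lfun_bv (V : vectType F) (f g : 'Hom(U, V)) : (forall i, f (basis_vec i) = g (basis_vec i)) -> f = g.
Proof.
move=> h; apply/lfunP => u; rewrite -(co_sum u) !linear_sum.
by apply: eq_bigr => i _; rewrite !linearZ /= h.
Qed.
End Basis.

Section Tensor.
Variable F : fieldType.
Implicit Types U V X : vectType F.

(* U (x) V is modelled by coordinate matrices; tpure u v is the pure tensor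
   u (x) v.  tlift_pure and tens_ext below give the universal property. *)
Definition tens U V : vectType F := 'M[F]_(\dim {:U}, \dim {:V}).

Definition tpure U V (u : U) (v : V) : tens U V := \matrix_(i, j) (coef i u * coef j v).

Definition bilin U V X (b : U -> V -> X) :=
  (forall v, linear (b^~ v)) /\ (forall u, linear (b u)).

Definition tlift_fun U V X (b : U -> V -> X) (M : tens U V) : X :=
  \sum_i \sum_j (M : 'M_(_, _)) i j *: b (basis_vec i) (basis_vec j).

Lemma tlift_fun_linear U V X (b : U -> V -> X) : linear (tlift_fun b).
Proof.
move=> a x y; rewrite /tlift_fun scaler_sumr -big_split /=; apply: eq_bigr => i _.
rewrite scaler_sumr -big_split /=; apply: eq_bigr => j _.
by rewrite !mxE scalerDl scalerA.
Qed.
HB.instance Definition _ U V X (b : U -> V -> X) :=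
  GRing.isSemilinear.Build F _ _ _ (tlift_fun b)
    (GRing.semilinear_linear (tlift_fun_linear b)).

Definition tlift U V X (b : U -> V -> X) : 'Hom(tens U V, X) := linfun (tlift_fun b).

Lemma pure_bilin U V : bilin (@tpure U V).
Proof.
by split=> wgen a x y; apply/matrixP => i j; rewrite !mxE linearP /= ?mulrDl ?mulrDr -?mulrA // mulrCA.
Qed.

Lemma tlift_pure U V X (b : U -> V -> X) u v : bilin b -> tlift b (tpure u v) = b u v.
Proof.
case=> bl br; rewrite lfunE /= /tlift_fun.
have sl v' : b u v' = \sum_i coef i u *: b (basis_vec i) v'.
  rewrite -[in LHS](co_sum u).
  pose f := HB.pack (b^~ v') (GRing.isSemilinear.Build F _ _ _ (b^~ v') (GRing.semilinear_linear (bl v'))) : {linear U -> X}.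
  by rewrite -[LHS]/(f _) linear_sum; apply: eq_bigr => i _; rewrite linearZ.
have sr u' : b u' v = \sum_j coef j v *: b u' (basis_vec j).
  rewrite -[in LHS](co_sum v).
  pose f := HB.pack (b u') (GRing.isSemilinear.Build F _ _ _ (b u') (GRing.semilinear_linear (br u'))) : {linear V -> X}.
  by rewrite -[LHS]/(f _) linear_sum; apply: eq_bigr => i _; rewrite linearZ.
rewrite sl; apply: eq_bigr => i _; rewrite sr scaler_sumr; apply: eq_bigr => j _.
by rewrite scalerA mxE.
Qed.

Lemma pure_sum U V (M : tens U V) :
  M = \sum_i \sum_j (M : 'M_(_, _)) i j *: tpure (basis_vec i) (basis_vec j).
Proof.
apply/matrixP => i j; rewrite summxE (bigD1 i) //= summxE (bigD1 j) //= !mxE !co_bv !eqxx !mulr1.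
rewrite !big1 ?addr0 // => [k nk|k nk]; rewrite ?summxE ?big1 // => *; rewrite !mxE !co_bv.
  by rewrite [i == k]eq_sym (negbTE nk) mul0r mulr0.
by rewrite [j == k]eq_sym (negbTE nk) !mulr0.
Qed.

Lemma tens_ext U V X (f g : 'Hom(tens U V, X)) :
  (forall u v, f (tpure u v) = g (tpure u v)) -> f = g.
Proof.
move=> h; apply/lfunP => M; rewrite (pure_sum M) !linear_sum; apply: eq_bigr => i _.
by rewrite !linear_sum; apply: eq_bigr => j _; rewrite !linearZ /= h.
Qed.

Definition tensf U U' V V' (f : 'Hom(U, U')) (g : 'Hom(V, V')) :
  'Hom(tens U V, tens U' V') := tlift (fun u v => tpure (f u) (g v)).

End Tensor.
Section TensorMaps.
Variable F : fieldType.
Implicit Types U V X Y : vectType F.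

Lemma pureDl U V u u' (v : V) : tpure (u + u' : U) v = tpure u v + tpure u' v.
Proof. by have := (@pure_bilin F U V).1 v 1 u u'; rewrite !scale1r. Qed.
Lemma pureDr U V (u : U) (v v' : V) : tpure u (v + v') = tpure u v + tpure u v'.
Proof. by have := (@pure_bilin F U V).2 u 1 v v'; rewrite !scale1r. Qed.
Lemma pure0l U V (v : V) : tpure (0 : U) v = 0.
Proof. by apply: (addrI (tpure 0 v)); rewrite -pureDl !addr0. Qed.
Lemma pure0r U V (u : U) : tpure u (0 : V) = 0.
Proof. by apply: (addrI (tpure u 0)); rewrite -pureDr !addr0. Qed.
Lemma pureZl U V a (u : U) (v : V) : tpure (a *: u) v = a *: tpure u v.
Proof. by have := (@pure_bilin F U V).1 v a u 0; rewrite pure0l !addr0. Qed.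
Lemma pureZr U V a (u : U) (v : V) : tpure u (a *: v) = a *: tpure u v.
Proof. by have := (@pure_bilin F U V).2 u a v 0; rewrite pure0r !addr0. Qed.
Lemma pure_suml U V I r (P : pred I) (f : I -> U) (v : V) :
  tpure (\sum_(i <- r | P i) f i) v = \sum_(i <- r | P i) tpure (f i) v.
Proof. by apply: (big_morph (fun u => tpure u v)) => [x y|]; rewrite ?pureDl ?pure0l. Qed.
Lemma pure_sumr U V I r (P : pred I) (f : I -> V) (u : U) :
  tpure u (\sum_(i <- r | P i) f i) = \sum_(i <- r | P i) tpure u (f i).
Proof. by apply: (big_morph (tpure u)) => [x y|]; rewrite ?pureDr ?pure0r. Qed.

Lemma tensf_pure U U' V V' (f : 'Hom(U, U')) (g : 'Hom(V, V')) u v :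
  tensf f g (tpure u v) = tpure (f u) (g v).
Proof.
by apply: (@tlift_pure F U V); split=> ? a x y; rewrite linearP ?pureDl ?pureDr ?pureZl ?pureZr.
Qed.

Lemma tensf1 U V : tensf \1 \1 = \1%VF :> 'End(tens U V).
Proof. by apply: tens_ext => u v; rewrite tensf_pure !id_lfunE. Qed.

Lemma tensf_comp U U' U'' V V' V'' (f : 'Hom(U, U')) (f' : 'Hom(U', U''))
    (g : 'Hom(V, V')) (g' : 'Hom(V', V'')) :
  tensf (f' \o f) (g' \o g) = (tensf f' g' \o tensf f g)%VF.
Proof. by apply: tens_ext => u v; rewrite comp_lfunE !tensf_pure !comp_lfunE. Qed.

Lemma tensf_suml U U' V V' I r (P : pred I) (f : I -> 'Hom(U, U')) (g : 'Hom(V, V')) :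
  tensf (\sum_(i <- r | P i) f i) g = \sum_(i <- r | P i) tensf (f i) g.
Proof.
apply: tens_ext => u v; rewrite tensf_pure !sum_lfunE pure_suml.
by apply: eq_bigr => i _; rewrite tensf_pure.
Qed.
Lemma tensf_sumr U U' V V' I r (P : pred I) (f : I -> 'Hom(V, V')) (g : 'Hom(U, U')) :
  tensf g (\sum_(i <- r | P i) f i) = \sum_(i <- r | P i) tensf g (f i).
Proof.
apply: tens_ext => u v; rewrite tensf_pure !sum_lfunE pure_sumr.
by apply: eq_bigr => i _; rewrite tensf_pure.
Qed.
Lemma tensfZl U U' V V' a (f : 'Hom(U, U')) (g : 'Hom(V, V')) :
  tensf (a *: f) g = a *: tensf f g.
Proof. by apply: tens_ext => u v; rewrite scale_lfunE !tensf_pure scale_lfunE pureZl. Qed.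
Lemma tensfZr U U' V V' a (f : 'Hom(U, U')) (g : 'Hom(V, V')) :
  tensf f (a *: g) = a *: tensf f g.
Proof. by apply: tens_ext => u v; rewrite scale_lfunE !tensf_pure scale_lfunE pureZr. Qed.
Lemma tensf_zmod U U' V V' (f : 'Hom(U, U')) : zmod_morphism (@tensf F U U' V V' f).
Proof.
move=> g h; apply: tens_ext => u v; rewrite add_lfunE opp_lfunE !tensf_pure add_lfunE opp_lfunE.
by rewrite pureDr -scaleN1r pureZr scaleN1r.
Qed.
Lemma tensf0l U U' V V' (g : 'Hom(V, V')) : tensf (0 : 'Hom(U, U')) g = 0.
Proof. by rewrite -[0 in LHS](scale0r 0) tensfZl scale0r. Qed.
Lemma tensf0r U U' V V' (f : 'Hom(U, U')) : tensf f (0 : 'Hom(V, V')) = 0.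
Proof. by rewrite -[0 in LHS](scale0r 0) tensfZr scale0r. Qed.

Definition tassoc U V X : 'Hom(tens (tens U V) X, tens U (tens V X)) :=
  tlift (fun t x => tlift (fun u v => tpure u (tpure v x)) t).
Definition tcomm U V : 'Hom(tens U V, tens V U) := tlift (fun u v => tpure v u).
Definition tlunit V : 'Hom(tens F^o V, V) := tlift (fun (c : F^o) v => c *: v).
Definition trunit V : 'Hom(tens V F^o, V) := tlift (fun v (c : F^o) => c *: v).

Lemma tassoc_pure U V X (u : U) (v : V) (x : X) :
  tassoc U V X (tpure (tpure u v) x) = tpure u (tpure v x).
Proof.
have b y : bilin (fun (u : U) (v : V) => tpure u (tpure v (y : X))).
  by split=> ? a p q; rewrite ?pureDl ?pureZl ?pureDr ?pureZr.
rewrite /tassoc tlift_pure ?tlift_pure //; split=> [y|t] a p q; first by rewrite linearP.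
rewrite !lfunE /= /tlift_fun scaler_sumr -big_split; apply: eq_bigr => i _ /=.
rewrite scaler_sumr -big_split; apply: eq_bigr => j _ /=.
by rewrite pureDr pureZr pureDr pureZr scalerDr !scalerA mulrC.
Qed.
Lemma tcomm_pure U V (u : U) (v : V) : tcomm U V (tpure u v) = tpure v u.
Proof. by apply: (@tlift_pure F U V); split=> ? a p q; rewrite ?pureDl ?pureZl ?pureDr ?pureZr. Qed.
Lemma tlunit_pure V c (v : V) : tlunit V (tpure (c : F^o) v) = c *: v.
Proof.
apply: (@tlift_pure F F^o V (V)); split=> [? a p q|? a p q]; first by rewrite scalerDl scalerA.
by rewrite scalerDr !scalerA mulrC.
Qed.
Lemma trunit_pure V c (v : V) : trunit V (tpure v (c : F^o)) = c *: v.
Proof.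
apply: (@tlift_pure F V F^o (V)); split=> [? a p q|? a p q]; last by rewrite scalerDl scalerA.
by rewrite scalerDr !scalerA mulrC.
Qed.

Lemma tens_ext3 U V X Y (f g : 'Hom(tens (tens U V) X, Y)) :
  (forall u v x, f (tpure (tpure u v) x) = g (tpure (tpure u v) x)) -> f = g.
Proof.
move=> h; apply: tens_ext => t x.
pose c : 'Hom(tens U V, tens (tens U V) X) := linfun (fun t => tpure t x).
have cE s : c s = tpure s x.
  pose f0 := HB.pack (fun t : tens U V => tpure t x) (GRing.isSemilinear.Build F _ _ _ (fun t : tens U V => tpure t x) (GRing.semilinear_linear ((@pure_bilin F _ _).1 x))) : {linear tens U V -> tens (tens U V) X}.
  exact: (lfunE f0).
rewrite -cE -!comp_lfunE; congr (fun_of_lfun _ t); apply: tens_ext => u v.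
by rewrite !comp_lfunE cE h.
Qed.
End TensorMaps.


(* The letter i of a word stands for the generator w_{i+1}, so that all lists
   of natural numbers are words in w_1, w_2, ... *)
Definition word := seq nat.
Definition wt (u : word) : nat := (\sum_(i <- u) i.+1)%N.

(* R<<w_1, w_2, ...>>: since each weight contains finitely many words, the
   completion by weight is the set of all families of coefficients indexed by
   words.  Pointwise addition, Cauchy product; W is ncseries k. *)
Definition ncseries (R : Type) := word -> R.

Section SeriesRing.
Variable R : nzRingType.
Implicit Types f g h : ncseries R.

HB.instance Definition _ := GRing.Zmodule.copy (ncseries R) (word -> R).

Definition ser_one : ncseries R := fun u => (u == [::])%:R.
Definition ser_mul f g : ncseries R :=
  fun u => \sum_(i < (size u).+1) f (take i u) * g (drop i u).

Definition dser n f : ncseries R := fun u => f (n :: u).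

Lemma ser_addE f g u : (f + g) u = f u + g u. Proof. by []. Qed.

Lemma ser_mul0 f g : ser_mul f g [::] = f [::] * g [::].
Proof. by rewrite /ser_mul big_ord_recl big_ord0 addr0. Qed.

Lemma ser_mulS f g n u :
  ser_mul f g (n :: u) = f [::] * g (n :: u) + ser_mul (dser n f) g u.
Proof. by rewrite /ser_mul big_ord_recl. Qed.

Lemma ser_mulDl : left_distributive ser_mul +%R.
Proof.
move=> f g h; apply: funext => u; rewrite ser_addE /ser_mul -big_split /=.
by apply: eq_bigr => i _; rewrite ser_addE mulrDl.
Qed.
Lemma ser_mulDr : right_distributive ser_mul +%R.
Proof.
move=> f g h; apply: funext => u; rewrite ser_addE /ser_mul -big_split /=.
by apply: eq_bigr => i _; rewrite ser_addE mulrDr.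
Qed.

Lemma ser_mulZl a f g u : ser_mul (fun v => a * f v) g u = a * ser_mul f g u.
Proof. by rewrite /ser_mul mulr_sumr; apply: eq_bigr => i _; rewrite mulrA. Qed.

Lemma ser_mulA : associative ser_mul.
Proof.
move=> f g h; apply: funext => u; elim: u f => [|n u IH] f.
  by rewrite !ser_mul0 mulrA.
rewrite !ser_mulS IH ser_mul0 mulrDr !mulrA -addrA; congr (_ + _).
rewrite -ser_mulZl -ser_addE -ser_mulDl; congr (ser_mul _ h u).
by apply: funext => v; rewrite /dser ser_mulS ser_addE.
Qed.

Lemma ser_mul1l : left_id ser_one ser_mul.
Proof.
move=> f; apply: funext => u; rewrite /ser_mul big_ord_recl take0 drop0 mul1r big1 ?addr0 //.
by case: u => [|n u] i _; [case: i|rewrite mul0r].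
Qed.
Lemma ser_mul1r : right_id ser_one ser_mul.
Proof.
move=> f; apply: funext => u; rewrite /ser_mul big_ord_recr /= take_size drop_size mulr1.
rewrite big1 ?add0r // => i _; rewrite /ser_one -size_eq0 size_drop subn_eq0 leqNgt.
by rewrite ltn_ord mulr0.
Qed.
Lemma ser_one_neq0 : ser_one != 0 :> ncseries R.
Proof. by apply/eqP => /(congr1 (fun f : word -> R => f [::])) /eqP; rewrite oner_eq0. Qed.

HB.instance Definition _ := GRing.Zmodule_isNzRing.Build (ncseries R)
  ser_mulA ser_mul1l ser_mul1r ser_mulDl ser_mulDr ser_one_neq0.
HB.instance Definition _ := GRing.Lmodule.copy (ncseries R) (word -> R^o).

Lemma ser_mulE f g u : (f * g) u = \sum_(i < (size u).+1) f (take i u) * g (drop i u).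
Proof. by []. Qed.
Lemma ser_oneE u : (1 : ncseries R) u = (u == [::])%:R. Proof. by []. Qed.
Lemma ser_scaleE a f u : (a *: f) u = a * f u. Proof. by []. Qed.
Lemma ser_scaleAl a f g : a *: (f * g) = (a *: f) * g.
Proof. by apply: funext => u; rewrite ser_scaleE -ser_mulZl. Qed.
HB.instance Definition _ := GRing.Lmodule_isLalgebra.Build R (ncseries R) ser_scaleAl.

Definition monom (u : word) : ncseries R := fun v => (v == u)%:R.

Definition wgen (n : nat) : ncseries R := if n is m.+1 then monom [:: m] else 1.

End SeriesRing.

Section SeriesAlg.
Variable k : comNzRingType.
Lemma ser_scaleAr (a : k) (f g : ncseries k) : a *: (f * g) = f * (a *: g).
Proof.
apply: funext => u; rewrite ser_scaleE !ser_mulE mulr_sumr.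
by apply: eq_bigr => i _; rewrite ser_scaleE mulrCA.
Qed.
HB.instance Definition _ := GRing.Lalgebra_isAlgebra.Build k (ncseries k) ser_scaleAr.

(* The completed tensor product of W with itself is ncseries (ncseries k):
   T u v is the coefficient of u (x) v, and the coefficients (right tensor
   factor) commute with the letters (left tensor factor), so that
   (a (x) b) (c (x) d) = ac (x) bd. *)
Definition stens (a b : ncseries k) : ncseries (ncseries k) := fun u => a u *: b.

Definition cop_gen (n : nat) : ncseries (ncseries k) :=
  \sum_(i < n.+1) stens (wgen k i) (wgen k (n - i)).

Definition cop_word (x : word) : ncseries (ncseries k) :=
  \prod_(n <- x) cop_gen n.+1.

(* The continuous multiplicative extension of w_n |-> sum_i w_i (x) w_{n-i};
   for fixed u and v only the finitely many words x of weight wt u + wt v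
   contribute. *)
Definition coproduct (a : ncseries k) : ncseries (ncseries k) :=
  fun u v => \sum_(x \in [set: word]) a x * cop_word x u v.
End SeriesAlg.


Lemma wt_nil : wt [::] = 0%N. Proof. by rewrite /wt big_nil. Qed.
Lemma wt_cons n u : wt (n :: u) = (n.+1 + wt u)%N. Proof. by rewrite /wt big_cons. Qed.
Lemma wt_cat u v : wt (u ++ v) = (wt u + wt v)%N. Proof. by rewrite /wt big_cat. Qed.

(* An explicit enumeration of the words of weight < N, used to compute the
   finitely supported sums. *)
Fixpoint words_len (m l : nat) : seq word :=
  if l is l'.+1 then [::] :: [seq i :: u | i <- iota 0 m, u <- words_len m l'] else [:: [::]].
Definition words N := undup [seq u <- words_len N N | wt u < N]%N.

Lemma words_len_mem m l u : (wt u <= m)%N -> (size u <= l)%N -> u \in words_len m l.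
Proof.
elim: l u => [|l IH] [|n u] //= h1; rewrite ?inE ?eqxx // ltnS => h2.
apply/orP; right; apply/allpairsP; exists (n, u); split => //=.
  by rewrite mem_iota /= add0n; apply: leq_trans h1; rewrite wt_cons addSn ltnS leq_addr.
by apply: IH => //; apply: leq_trans h1; rewrite wt_cons leq_addl.
Qed.

Lemma size_wt u : (size u <= wt u)%N.
Proof. by elim: u => [|n u IH] //=; rewrite wt_cons addSn ltnS (leq_trans IH) ?leq_addl. Qed.

Lemma mem_words N u : (u \in words N) = (wt u < N)%N.
Proof.
rewrite mem_undup mem_filter; case: ltnP => //= h.
by rewrite words_len_mem ?(ltnW h) // (leq_trans (size_wt u)) // ltnW.
Qed.

Lemma uniq_words N : uniq (words N). Proof. exact: undup_uniq. Qed.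

Lemma fsum_seq (I : choiceType) (V : zmodType) (L : seq I) (G : I -> V) :
  uniq L -> (forall i, i \notin L -> G i = 0) ->
  \sum_(i \in [set: I]) G i = \sum_(i <- L) G i.
Proof.
move=> uL h; rewrite (fsbigE L) //; last by move=> i _; apply: h.
by apply: eq_bigl => i; rewrite in_setT.
Qed.

Lemma fsum_words N (V : zmodType) (G : word -> V) :
  (forall u, (N <= wt u)%N -> G u = 0) ->
  \sum_(u \in [set: word]) G u = \sum_(u <- words N) G u.
Proof.
by move=> h; apply: fsum_seq (uniq_words N) _ => u; rewrite mem_words -leqNgt; apply: h.
Qed.

Lemma sum_split_words N (V : zmodType) (G : word -> word -> V) :
  (forall u v, (N <= wt u + wt v)%N -> G u v = 0) ->
  \sum_(u <- words N) \sum_(i < (size u).+1) G (take i u) (drop i u)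
  = \sum_(u <- words N) \sum_(v <- words N) G u v.
Proof.
move=> h.
transitivity (\sum_(p <- [seq (take i u, drop i u) | u <- words N, i <- iota 0 (size u).+1]) G p.1 p.2).
  rewrite big_allpairs_dep; apply: eq_bigr => u _ /=.
  by rewrite -(big_mkord xpredT (fun i => G (take i u) (drop i u))) /index_iota subn0.
transitivity (\sum_(p <- [seq (u, v) | u <- words N, v <- words N]) G p.1 p.2); last by rewrite big_allpairs_dep.
set L := [seq (u, v) | u <- _, v <- _].
have -> : \sum_(p <- L) G p.1 p.2 = \sum_(p <- L | (wt p.1 + wt p.2 < N)%N) G p.1 p.2.
  by rewrite [RHS]big_mkcond; apply: eq_bigr => p _; case: ltnP => // /h.
rewrite -[RHS]big_filter; apply: perm_big; rewrite {}/L; apply: uniq_perm.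
- apply: (@allpairs_uniq_dep word (fun=> nat) _ (fun u i => (take i u, drop i u))).
  + exact: uniq_words.
  + by move=> u _; apply: iota_uniq.
  have fl (p q : {x : word & nat}) : (tag p, tagged p) = (tag q, tagged q) -> p = q.
    by case: p q => [? ?] [? ?] /= [-> ->].
  move=> [u i] [v j] /allpairsPdep[u' [i' [_ + /(congr1 (fun p : {x : word & nat} => (tag p, tagged p))) [-> ->]]]].
  rewrite mem_iota add0n ltnS => /andP[_ hi].
  move=> /allpairsPdep[v' [j' [_ + /(congr1 (fun p : {x : word & nat} => (tag p, tagged p))) [-> ->]]]].
  rewrite mem_iota add0n ltnS => /andP[_ hj] /= [e1 e2]; apply: fl => /=.
  have euv : u' = v' by rewrite -(cat_take_drop i' u') -(cat_take_drop j' v') e1 e2.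
  by subst v'; move: (congr1 size e1); rewrite !size_takel // => ->.
- by rewrite filter_uniq // allpairs_uniq_dep // ?uniq_words // => -[u v] [u' v'] _ _ /= [-> ->].
move=> [u v]; rewrite mem_filter; apply/allpairsPdep/andP => /=.
  move=> [x [i [hx _ [-> ->]]]]; rewrite -wt_cat cat_take_drop -mem_words hx; split=> //.
  apply/allpairsP; exists (take i x, drop i x); rewrite !mem_words /=.
  move: hx; rewrite mem_words -{1}(cat_take_drop i x) wt_cat => hx.
  by split=> //; apply: leq_ltn_trans hx; rewrite ?leq_addr ?leq_addl.
have hm : size u \in iota 0 (size (u ++ v)).+1 by rewrite mem_iota /= add0n ltnS size_cat leq_addr.
move=> [hw _]; exists (u ++ v), (size u); split=> //; first by rewrite mem_words wt_cat.
by rewrite take_size_cat // drop_size_cat.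
Qed.

Lemma coproduct_monom (k : comNzRingType) x : coproduct (monom k x) = cop_word k x.
Proof.
apply: funext => u; apply: funext => v; rewrite /coproduct (@fsum_seq _ _ [:: x]) //.
  by rewrite big_seq1 /monom eqxx mul1r.
by move=> y; rewrite inE /monom => /negbTE ->; rewrite mul0r.
Qed.

Lemma coproduct_wgen (k : comNzRingType) n :
  coproduct (wgen k n) = \sum_(i < n.+1) stens (wgen k i) (wgen k (n - i)).
Proof.
case: n => [|n]; last by rewrite (coproduct_monom k [:: n]) /cop_word big_seq1.
rewrite (coproduct_monom k [::]) /cop_word big_nil big_ord_recl big_ord0 addr0.
apply: funext => u; rewrite ser_oneE -[RHS]/((u == [::])%:R *: (1 : ncseries k)).
case: (u == [::]); first by rewrite scale1r.
by rewrite scale0r.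
Qed.


Section CompSum.
Variables (F : fieldType) (U V W : vectType F).
Lemma comp_suml I r (P : pred I) (f : I -> 'Hom(V, W)) (g : 'Hom(U, V)) :
  ((\sum_(i <- r | P i) f i) \o g = \sum_(i <- r | P i) (f i \o g))%VF.
Proof. by apply: (big_morph (fun f => f \o g)%VF) => [x y|]; rewrite ?comp_lfunDl ?comp_lfun0l. Qed.
Lemma comp_sumr I r (P : pred I) (f : I -> 'Hom(U, V)) (g : 'Hom(V, W)) :
  (g \o (\sum_(i <- r | P i) f i) = \sum_(i <- r | P i) (g \o f i))%VF.
Proof. by apply: (big_morph (fun f => g \o f)%VF) => [x y|]; rewrite ?comp_lfunDr ?comp_lfun0r. Qed.
End CompSum.

(* Evaluation of a series at a representation R of the words that vanishes in
   large weight, the coefficients acting through th. *)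
Section Eval.
Variables (F : fieldType) (M : vectType F) (A : nzRingType).
Variables (th : {additive A -> 'End(M)}) (R : word -> 'End(M)) (N : nat).
Hypothesis th1 : th 1 = \1%VF.
Hypothesis thM : forall a b, th (a * b) = (th a \o th b)%VF.
Hypothesis R0 : R [::] = \1%VF.
Hypothesis RM : forall u v, R (u ++ v) = (R u \o R v)%VF.
Hypothesis thR : forall a u, (th a \o R u = R u \o th a)%VF.
Hypothesis RN : forall u, (N <= wt u)%N -> R u = 0.

Definition ev (f : ncseries A) : 'End(M) :=
  \sum_(u \in [set: word]) (th (f u) \o R u)%VF.

Lemma evE N' f : (N <= N')%N -> ev f = \sum_(u <- words N') (th (f u) \o R u)%VF.
Proof.
by move=> le; apply: fsum_words => u hu; rewrite RN ?comp_lfun0r // (leq_trans le).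
Qed.

Lemma ev_additive : zmod_morphism ev.
Proof.
move=> f g; rewrite !(evE _ (leqnn N)) -sumrB; apply: eq_bigr => u _.
by rewrite -comp_lfunNl -comp_lfunDl -raddfB.
Qed.

Lemma ev_mono u : ev (monom A u) = R u.
Proof.
rewrite (evE _ (leq_maxl N (wt u).+1)) (bigD1_seq u) ?uniq_words ?mem_words //=; last first.
  by rewrite leq_maxr.
rewrite /monom eqxx th1 comp_lfun1l big1 ?addr0 // => v /negbTE ->.
by rewrite raddf0 comp_lfun0l.
Qed.

Lemma ev1 : ev 1 = \1%VF.
Proof. by rewrite -R0 -ev_mono. Qed.

Lemma evM f g : ev (f * g) = (ev f \o ev g)%VF.
Proof.
rewrite !(evE _ (leqnn N)).
transitivity (\sum_(u <- words N) \sum_(i < (size u).+1)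
   ((th (f (take i u)) \o R (take i u)) \o (th (g (drop i u)) \o R (drop i u)))%VF).
  apply: eq_bigr => u _; rewrite ser_mulE raddf_sum comp_suml; apply: eq_bigr => i _.
  have -> : R u = (R (take i u) \o R (drop i u))%VF by rewrite -RM cat_take_drop.
  rewrite thM -!comp_lfunA; congr (_ \o _)%VF.
  by rewrite !comp_lfunA thR.
rewrite (@sum_split_words N _ (fun u v => (th (f u) \o R u) \o (th (g v) \o R v))%VF); last first.
  move=> u v h; rewrite -comp_lfunA [X in (_ \o X)%VF]comp_lfunA -thR.
  by rewrite -comp_lfunA -RM RN ?comp_lfun0r // wt_cat.
by rewrite comp_suml; apply: eq_bigr => u _; rewrite comp_sumr.
Qed.

End Eval.


Local Notation tofrac := (@FracField.tofrac _).
Section RationalFunctions.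
Variable k : fieldType.

Definition ratfun : fieldType := {fraction {poly k}}.
Definition ratC (c : k) : ratfun := tofrac c%:P.
Definition var_s : ratfun := tofrac 'X.

Lemma cst_zmod : zmod_morphism ratC.
Proof. by move=> x y; rewrite /ratC !rmorphB. Qed.
Lemma cst_monoid : monoid_morphism ratC.
Proof. by split => [|x y]; rewrite /ratC ?rmorph1 ?rmorphM. Qed.
HB.instance Definition _ := GRing.isZmodMorphism.Build k ratfun ratC cst_zmod.
HB.instance Definition _ := GRing.isMonoidMorphism.Build k ratfun ratC cst_monoid.

Definition subst_s (c : k) (p : {poly k}) : ratfun := tofrac (p \Po ('X + c%:P)).

(* f(s) |-> f(s + c), computed on the canonical representative of f. *)
Definition translate (c : k) (x : ratfun) : ratfun :=
  subst_s c (frac (repr x)).1 / subst_s c (frac (repr x)).2.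

Lemma ratfunE (x : ratfun) :
  x = tofrac (frac (repr x)).1 / tofrac (frac (repr x)).2.
Proof.
have d0 : tofrac (frac (repr x)).2 != 0 :> ratfun by rewrite tofrac_eq0 denom_ratioP.
apply: (canRL (mulfK d0)).
rewrite -{1}[x]reprK; set r := repr x; unlock FracField.tofrac.
rewrite -[LHS]FracField.pi_mul; apply/eqmodP; rewrite /= FracField.equivfE.
rewrite /FracField.mulf !numden_Ratio ?mulr1 ?mulf_neq0 ?oner_neq0 ?denom_ratioP //.
by rewrite mulrC.
Qed.

Lemma subst_s_eq0 c p : (subst_s c p == 0) = (p == 0).
Proof. by rewrite tofrac_eq0 comp_poly2_eq0 // size_XaddC. Qed.

Lemma subst_sM c p q : subst_s c (p * q) = subst_s c p * subst_s c q.
Proof. by rewrite /subst_s comp_polyM rmorphM. Qed.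

Lemma subst_sD c p q : subst_s c (p + q) = subst_s c p + subst_s c q.
Proof. by rewrite /subst_s comp_polyD rmorphD. Qed.

Lemma translateE c p q : q != 0 ->
  translate c (tofrac p / tofrac q) = subst_s c p / subst_s c q.
Proof.
move=> q0; rewrite /translate; set x := tofrac p / tofrac q.
have d0 : (frac (repr x)).2 != 0 by rewrite denom_ratioP.
have /eqP := ratfunE x; rewrite {1}/x eqr_div ?tofrac_eq0 // -!tofracM tofrac_eq => /eqP e.
by apply/eqP; rewrite eqr_div ?subst_s_eq0 // -!subst_sM e.
Qed.

Lemma translate_poly c p : translate c (tofrac p) = subst_s c p.
Proof.
have := @translateE c p 1 (oner_neq0 _).
by rewrite /subst_s rmorph1 comp_polyC rmorph1 !divr1.
Qed.

Lemma translate_zmod c : zmod_morphism (translate c).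
Proof.
suff tD x y : translate c (x + y) = translate c x + translate c y.
  by move=> x y; apply/eqP; rewrite eq_sym subr_eq -tD subrK.
rewrite (ratfunE x) (ratfunE y).
move: (frac (repr x)) (denom_ratioP (repr x)) (frac (repr y)) (denom_ratioP (repr y)).
move=> [n d] /= d0 [n' d'] /= d0'.
rewrite addf_div ?tofrac_eq0 // -!tofracM -tofracD !translateE ?mulf_neq0 //.
by rewrite addf_div ?subst_s_eq0 // subst_sD !subst_sM.
Qed.

Lemma translate_monoid c : monoid_morphism (translate c).
Proof.
split=> [|x y]; first by rewrite -[1](@tofrac1 {poly k}) translate_poly /subst_s comp_polyC.
rewrite (ratfunE x) (ratfunE y).
move: (frac (repr x)) (denom_ratioP (repr x)) (frac (repr y)) (denom_ratioP (repr y)).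
move=> [n d] /= d0 [n' d'] /= d0'.
by rewrite mulf_div -!tofracM !translateE ?mulf_neq0 // mulf_div !subst_sM.
Qed.
HB.instance Definition _ c := GRing.isZmodMorphism.Build ratfun ratfun (translate c) (translate_zmod c).
HB.instance Definition _ c := GRing.isMonoidMorphism.Build ratfun ratfun (translate c) (translate_monoid c).

Lemma translate_cst c a : translate c (ratC a) = ratC a.
Proof. by rewrite translate_poly /subst_s comp_polyC. Qed.

Lemma translate_s c : translate c var_s = var_s + ratC c.
Proof. by rewrite translate_poly /subst_s comp_polyX rmorphD. Qed.

Lemma translateD c d x : translate c (translate d x) = translate (c + d) x.
Proof.
have tp p : translate c (subst_s d p) = subst_s (c + d) p.
  rewrite translate_poly /subst_s -comp_polyA; congr (tofrac (p \Po _)).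
  by rewrite comp_polyD comp_polyX comp_polyC rmorphD /= addrA.
rewrite (ratfunE x).
move: (frac (repr x)) (denom_ratioP (repr x)) => [n e] /= e0.
by rewrite (translateE d) // (translateE (c + d)) // fmorph_div /= !tp.
Qed.

Lemma translate0 x : translate 0 x = x.
Proof. by rewrite [RHS]ratfunE /translate /subst_s addr0 !comp_polyXr. Qed.

Lemma translateK c : cancel (translate c) (translate (- c)).
Proof. by move=> x; rewrite translateD addNr translate0. Qed.
Lemma translateVK c : cancel (translate (- c)) (translate c).
Proof. by move=> x; rewrite translateD addrN translate0. Qed.

Definition sigma : ratfun -> ratfun := translate 1.
HB.instance Definition _ := GRing.RMorphism.on sigma.
Lemma sigma_bij : bijective sigma.
Proof. by exists (translate (-1)); [exact: translateK | exact: translateVK]. Qed.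
End RationalFunctions.
Arguments var_s {k}.
Arguments ratC {k}.


Record wmod (k : fieldType) := WMod {
  wmod_space :> vectType k;
  rho : {linear ncseries k -> 'End(wmod_space)};
  rho1 : rho 1 = \1%VF;
  rhoM : forall a b, rho (a * b) = (rho a \o rho b)%VF;
  rho_continuous : exists N, forall a : ncseries k,
    (forall u, (wt u < N)%N -> a u = 0) -> rho a = 0 }.

Record wmor (k : fieldType) (V V' : wmod k) := WMor {
  wmor_map :> 'Hom(V, V');
  wmorP : forall a v, wmor_map (rho V a v) = rho V' a (wmor_map v) }.

Lemma wmor_eq (k : fieldType) (V V' : wmod k) (f g : wmor V V') :
  (f = g :> 'Hom(V, V')) -> f = g.
Proof. by case: f g => [f ?] [g ?] /= e; subst g; congr WMor; exact: Prop_irrelevance. Qed.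

Section WModules.
Variable k : fieldType.
Implicit Types V : wmod k.

Lemma mono_cat u v : monom k (u ++ v) = monom k u * monom k v.
Proof.
apply: funext; elim: u => [|n u IH] x.
  by rewrite -[monom k [::]]/(1 : ncseries k) mul1r.
have eqmono m : dser m (monom k (n :: u)) = if m == n then monom k u else 0.
  apply: funext => y; rewrite /dser /monom eqseq_cons; case: (m == n) => //=.
case: x => [|m x] /=; rewrite -[RHS]/(ser_mul _ _ _) ?ser_mul0 ?ser_mulS.
  by rewrite {2}/monom mul0r.
rewrite {2}/monom /= mul0r add0r eqmono /monom eqseq_cons; case: (m == n) => /=.
  by rewrite -/(monom k (u ++ v) x) IH.
by rewrite -[ser_mul _ _]/((0 : ncseries k) * _) mul0r.
Qed.

Section OneModule.
Variable V : wmod k.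
Lemma rho_mono0 : rho V (monom k [::]) = \1%VF. Proof. exact: rho1. Qed.
Lemma rho_mono_cat u v : rho V (monom k (u ++ v)) = (rho V (monom k u) \o rho V (monom k v))%VF.
Proof. by rewrite mono_cat rhoM. Qed.
Lemma rho_bound : exists N, forall a : ncseries k,
    (forall u, (wt u < N)%N -> a u = 0) -> rho V a = 0.
Proof. exact: rho_continuous. Qed.
Lemma rho_mono_bound N : (forall a : ncseries k,
    (forall u, (wt u < N)%N -> a u = 0) -> rho V a = 0) ->
  forall u, (N <= wt u)%N -> rho V (monom k u) = 0.
Proof.
move=> h u hu; apply: h => v hv; rewrite /monom; case: eqP => // e.
by move: hv; rewrite e ltnNge hu.
Qed.

Lemma rhoE N : (forall a : ncseries k,
    (forall u, (wt u < N)%N -> a u = 0) -> rho V a = 0) ->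
  forall a, rho V a = \sum_(u <- words N) a u *: rho V (monom k u).
Proof.
move=> h a; apply/eqP; rewrite -subr_eq0.
under eq_bigr do rewrite -linearZ.
rewrite -linear_sum -linearB /=; apply/eqP/h => u hu.
have sE (r : seq word) (f : word -> ncseries k) : (\sum_(x <- r) f x) u = \sum_(x <- r) f x u.
  by elim: r => [|y r IH]; rewrite ?big_nil // !big_cons ser_addE IH.
rewrite -[LHS]/(a u - (\sum_(x <- words N) a x *: monom k x) u) sE.
rewrite (bigD1_seq u) ?uniq_words ?mem_words //= big1 ?addr0.
  by rewrite ser_scaleE /monom eqxx mulr1 subrr.
by move=> x /negbTE; rewrite ser_scaleE /monom eq_sym => ->; rewrite mulr0.
Qed.

Lemma rho_fsum a : rho V a = \sum_(u \in [set: word]) a u *: rho V (monom k u).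
Proof.
have [N h] := rho_bound; rewrite (rhoE h) (@fsum_words N) // => u /(rho_mono_bound h) ->.
by rewrite scaler0.
Qed.
End OneModule.

Lemma wmor_gen V V' (f : 'Hom(V, V')) :
  (forall n, (f \o rho V (wgen k n) = rho V' (wgen k n) \o f)%VF) ->
  forall a v, f (rho V a v) = rho V' a (f v).
Proof.
move=> h a v; rewrite -!comp_lfunE; congr (fun_of_lfun _ v).
have hm u : (f \o rho V (monom k u) = rho V' (monom k u) \o f)%VF.
  elim: u => [|n u IH]; first by rewrite !rho_mono0 comp_lfun1l comp_lfun1r.
  rewrite -cat1s !rho_mono_cat -comp_lfunA -IH !comp_lfunA; congr (_ \o _)%VF.
  exact: (h n.+1).
have [N hN] := rho_bound V; have [N' hN'] := rho_bound V'.
rewrite (@rhoE V (maxn N N')) ?(@rhoE V' (maxn N N')); last first.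
- by move=> b hb; apply: hN => u hu; apply: hb; rewrite leq_max hu.
- by move=> b hb; apply: hN' => u hu; apply: hb; rewrite leq_max hu orbT.
rewrite comp_suml comp_sumr; apply: eq_bigr => u _.
by rewrite -comp_lfunZl -comp_lfunZr hm.
Qed.

(* The unit object: W acts on k through the counit, i.e. the constant term. *)
Definition unit_rho (a : ncseries k) : 'End(k^o) := a [::] *: \1%VF.
Lemma unit_rho_linear : linear unit_rho.
Proof. by move=> c a b; rewrite /unit_rho ser_addE ser_scaleE scalerDl scalerA. Qed.
HB.instance Definition _ := GRing.isSemilinear.Build k (ncseries k) 'End(k^o) _ unit_rho
  (GRing.semilinear_linear unit_rho_linear).
Lemma unit_rho1 : unit_rho 1 = \1%VF.
Proof. by rewrite /unit_rho ser_oneE scale1r. Qed.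
Lemma unit_rhoM a b : unit_rho (a * b) = (unit_rho a \o unit_rho b)%VF.
Proof.
by rewrite /unit_rho -[(a * b) _]/(ser_mul a b _) ser_mul0 -comp_lfunZl -comp_lfunZr comp_lfun1l scalerA.
Qed.
Lemma unit_rho_cont : exists N, forall a : ncseries k,
  (forall u, (wt u < N)%N -> a u = 0) -> unit_rho a = 0.
Proof. by exists 1%N => a h; rewrite /unit_rho h ?scale0r // wt_nil. Qed.
Definition wunit : wmod k := WMod unit_rho1 unit_rhoM unit_rho_cont.

Section Tensor.
Variables V V' : wmod k.

(* a acts on V (x) V' through Delta_*(a): p.1 (x) p.2 runs over all pairs of
   words, finitely many of which act by a nonzero operator. *)
Definition tens_rho (a : ncseries k) : 'End(tens V V') :=
  \sum_(p \in [set: word * word])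
    coproduct a p.1 p.2 *: tensf (rho V (monom k p.1)) (rho V' (monom k p.2)).

Let th (b : ncseries k) : 'End(tens V V') := tensf \1 (rho V' b).
Let R (u : word) : 'End(tens V V') := tensf (rho V (monom k u)) \1.

Lemma th_zmod : zmod_morphism th.
Proof. by move=> a b; rewrite /th linearB tensf_zmod. Qed.
HB.instance Definition _ := GRing.isZmodMorphism.Build (ncseries k) 'End(tens V V') th th_zmod.

Lemma th1 : th 1 = \1%VF. Proof. by rewrite /th rho1 tensf1. Qed.
Lemma thM a b : th (a * b) = (th a \o th b)%VF.
Proof. by rewrite /th rhoM -tensf_comp comp_lfun1l. Qed.
Lemma tR0 : R [::] = \1%VF. Proof. by rewrite /R rho_mono0 tensf1. Qed.
Lemma tRM u v : R (u ++ v) = (R u \o R v)%VF.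
Proof. by rewrite /R rho_mono_cat -tensf_comp comp_lfun1l. Qed.
Lemma thR a u : (th a \o R u = R u \o th a)%VF.
Proof. by rewrite -!tensf_comp !comp_lfun1l !comp_lfun1r. Qed.

Definition E2 : ncseries (ncseries k) -> 'End(tens V V') := ev th R.

Let tt u v : 'End(tens V V') := tensf (rho V (monom k u)) (rho V' (monom k v)).

Variables N1 N2 : nat.
Hypothesis h1 : forall a : ncseries k, (forall u, (wt u < N1)%N -> a u = 0) -> rho V a = 0.
Hypothesis h2 : forall a : ncseries k, (forall u, (wt u < N2)%N -> a u = 0) -> rho V' a = 0.

Lemma tRN u : (N1 <= wt u)%N -> R u = 0.
Proof. by move=> hu; rewrite /R (rho_mono_bound h1) // tensf0l. Qed.

Lemma E2E T : E2 T = \sum_(u <- words N1) \sum_(v <- words N2) T u v *: tt u v.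
Proof.
rewrite /E2 (evE _ tRN _ (leqnn _)); apply: eq_bigr => u _.
rewrite -tensf_comp comp_lfun1l comp_lfun1r (rhoE h2) tensf_sumr.
by apply: eq_bigr => v _; rewrite tensfZr.
Qed.

Lemma tens_rhoE a : tens_rho a = E2 (coproduct a).
Proof.
rewrite E2E /tens_rho.
transitivity (\sum_(p <- [seq (u, v) | u <- words N1, v <- words N2]) coproduct a p.1 p.2 *: tt p.1 p.2); last by rewrite big_allpairs.
apply: fsum_seq; first by rewrite allpairs_uniq ?uniq_words // => -[? ?] [? ?] _ _ [-> ->].
move=> [u v] hp /=; rewrite -/(tt _ _); suff -> : tt u v = 0 by rewrite scaler0.
have [lu|lu] := leqP N1 (wt u); first by rewrite /tt (rho_mono_bound h1) // tensf0l.
have [lv|lv] := leqP N2 (wt v); first by rewrite /tt (rho_mono_bound h2) // tensf0r.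
by move: hp => /negP[]; apply/allpairsP; exists (u, v); rewrite !mem_words.
Qed.

Lemma E2_1 : E2 1 = \1%VF. Proof. exact: (ev1 th1 tR0 tRN). Qed.
Lemma E2_M S T : E2 (S * T) = (E2 S \o E2 T)%VF.
Proof. exact: (evM thM tRM thR tRN). Qed.

Lemma E2_stens a b : E2 (stens a b) = tensf (rho V a) (rho V' b).
Proof.
rewrite E2E (rhoE h1 a) tensf_suml; apply: eq_bigr => u _.
rewrite (rhoE h2 b) tensf_sumr; apply: eq_bigr => v _.
by rewrite tensfZl tensfZr scalerA.
Qed.

Lemma E2_gen n : E2 (cop_gen k n) = \sum_(i < n.+1) tensf (rho V (wgen k i)) (rho V' (wgen k (n - i))).
Proof.
have E2B : zmod_morphism E2 := ev_additive _ tRN.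
pose f := HB.pack E2 (GRing.isZmodMorphism.Build _ _ E2 E2B) : {additive ncseries (ncseries k) -> 'End(tens V V')}.
by rewrite -[LHS]/(f _) raddf_sum; apply: eq_bigr => i _; apply: E2_stens.
Qed.

Lemma E2_tail T : (forall u v, (wt u < N1)%N -> (wt v < N2)%N -> T u v = 0) -> E2 T = 0.
Proof.
move=> h; rewrite E2E big_seq big1 // => u; rewrite mem_words => hu.
by rewrite big_seq big1 // => v; rewrite mem_words => hv; rewrite h // scale0r.
Qed.

Lemma cop_word_wt x u v : cop_word k x u v != 0 -> wt x = (wt u + wt v)%N.
Proof.
elim: x u v => [|n x IH] u v.
  rewrite /cop_word big_nil ser_oneE; case: u => [|? ?] /=; last by rewrite eqxx.
  by rewrite -[_ v]/((v == [::])%:R : k); case: v => [|? ?] /=; rewrite ?eqxx ?wt_nil.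
have sE I (r : seq I) (P : pred I) (f : I -> ncseries k) v' : (\sum_(i <- r | P i) f i) v' = \sum_(i <- r | P i) f i v'.
  by apply: (big_morph (fun g : ncseries k => g v')).
have sE2 I (r : seq I) (P : pred I) (f : I -> ncseries (ncseries k)) v' : (\sum_(i <- r | P i) f i) v' = \sum_(i <- r | P i) f i v'.
  by apply: (big_morph (fun g : ncseries (ncseries k) => g v')).
rewrite /cop_word big_cons -/(cop_word k x) => nz.
have [i [j [nz1 nz2]]] : exists i j, cop_gen k n.+1 (take i u) (take j v) != 0 /\
    cop_word k x (drop i u) (drop j v) != 0.
  apply: contrapT => H; move/eqP: nz; apply.
  rewrite ser_mulE sE big1 // => i _; rewrite ser_mulE big1 // => j _.
  apply/eqP; rewrite mulf_eq0.
  apply: contrapT => /negP; rewrite negb_or => /andP[? ?]; apply: H; by exists i, j.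
rewrite wt_cons (IH _ _ nz2) -[in RHS](cat_take_drop i u) -[X in _ = (_ + wt X)%N](cat_take_drop j v).
rewrite !wt_cat addnACA; congr (_ + _)%N.
move: (take i u) (take j v) nz1 => u1 v1 nz1.
have [i0 nz3] : exists i0 : 'I_n.+2, stens (wgen k i0) (wgen k (n.+1 - i0)) u1 v1 != 0.
  apply: contrapT => H; move/eqP: nz1; apply; rewrite /cop_gen sE2 sE big1 // => i0 _.
  by apply/eqP; apply: contrapT => /negP ?; apply: H; exists i0.
have wsupp m y : wgen k m y != 0 -> wt y = m.
  case: m => [|m] /=; first by rewrite ser_oneE; case: y => [|? ?]; rewrite /= ?eqxx // wt_nil.
  by rewrite /monom; case: (y =P [:: m]) => [-> _|_]; rewrite ?eqxx // wt_cons wt_nil addn0.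
move: nz3; rewrite /stens ser_scaleE mulf_eq0 negb_or => /andP[/wsupp -> /wsupp ->].
by rewrite subnKC // -ltnS.
Qed.

Let tR (x : word) := E2 (cop_word k x).

Lemma tR_bound x : (N1 + N2 <= wt x)%N -> tR x = 0.
Proof.
move=> hx; apply: E2_tail => u v hu hv; apply: contrapT => /eqP /cop_word_wt e.
by move: hx; rewrite e leqNgt -addSn leq_add // ltnW.
Qed.

Lemma tens_rhoE' a : tens_rho a = \sum_(x <- words (N1 + N2)) a x *: tR x.
Proof.
rewrite tens_rhoE E2E.
under [RHS]eq_bigr do rewrite /tR E2E scaler_sumr.
rewrite [RHS]exchange_big /= big_seq [RHS]big_seq; apply: eq_bigr => u; rewrite mem_words => hu.
under [RHS]eq_bigr do rewrite scaler_sumr.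
rewrite [RHS]exchange_big /= big_seq [RHS]big_seq; apply: eq_bigr => v; rewrite mem_words => hv.
rewrite /coproduct (@fsum_words (N1 + N2)); last first.
  move=> x hx; apply/eqP; rewrite mulf_eq0; apply/orP; right; apply/eqP; apply: contrapT => /eqP /cop_word_wt e.
  by move: hx; rewrite e leqNgt -addSn leq_add // ltnW.
by rewrite scaler_suml; apply: eq_bigr => x _; rewrite scalerA.
Qed.
End Tensor.
End WModules.


Section TensorModule.
Variable k : fieldType.

Section Scal.
Variable M : vectType k.
Definition scal (c : k) : 'End(M) := c *: \1%VF.
Lemma scal_zmod : zmod_morphism scal.
Proof. by move=> a b; rewrite /scal scalerBl. Qed.
HB.instance Definition _ := GRing.isZmodMorphism.Build k 'End(M) scal scal_zmod.
Lemma scal1 : scal 1 = \1%VF. Proof. by rewrite /scal scale1r. Qed.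
Lemma scal_comp a (f : 'End(M)) : (scal a \o f = a *: f)%VF.
Proof. by rewrite /scal -comp_lfunZl comp_lfun1l. Qed.
Lemma scalM a b : scal (a * b) = (scal a \o scal b)%VF.
Proof. by rewrite scal_comp /scal scalerA. Qed.
Lemma scalC a (f : 'End(M)) : (scal a \o f = f \o scal a)%VF.
Proof. by rewrite scal_comp /scal -comp_lfunZr comp_lfun1r. Qed.
End Scal.

Variables V V' : wmod k.

Lemma tens_rho_words : exists N, exists R : word -> 'End(tens V V'),
  [/\ R [::] = \1%VF, forall u v, R (u ++ v) = (R u \o R v)%VF,
      forall u, (N <= wt u)%N -> R u = 0,
      forall n, R [:: n] = \sum_(i < n.+2) tensf (rho V (wgen k i)) (rho V' (wgen k (n.+1 - i))) &
      forall a, tens_rho V V' a = ev (@scal (tens V V')) R a].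
Proof.
have [N1 h1] := rho_bound V; have [N2 h2] := rho_bound V'.
exists (N1 + N2)%N, (fun x => E2 V V' (cop_word k x)); split.
- by rewrite /cop_word big_nil (E2_1 V' h1).
- by move=> u v; rewrite /cop_word big_cat (E2_M _ h1).
- by move=> u; apply: tR_bound.
- by move=> n; rewrite /cop_word big_seq1 (E2_gen h1 h2).
move=> a; rewrite (tens_rhoE' h1 h2) (evE _ _ _ (leqnn (N1 + N2))); last by move=> u; apply: tR_bound.
by apply: eq_bigr => x _; rewrite scal_comp.
Qed.

Lemma tens_rho_linear : linear (@tens_rho k V V').
Proof.
have [N [R [R0 RM RN _ tE]]] := tens_rho_words.
move=> c a b; rewrite !tE !(evE _ RN _ (leqnn N)) scaler_sumr -big_split; apply: eq_bigr => u _ /=.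
by rewrite !scal_comp ser_addE ser_scaleE scalerDl scalerA.
Qed.
HB.instance Definition _ := GRing.isSemilinear.Build k (ncseries k) 'End(tens V V') _ (@tens_rho k V V')
  (GRing.semilinear_linear tens_rho_linear).

Lemma tens_rho1 : tens_rho V V' 1 = \1%VF.
Proof.
have [N [R [R0 RM RN _ tE]]] := tens_rho_words.
by rewrite tE (ev1 (@scal1 _) R0 RN).
Qed.
Lemma tens_rhoM a b : tens_rho V V' (a * b) = (tens_rho V V' a \o tens_rho V V' b)%VF.
Proof.
have [N [R [R0 RM RN _ tE]]] := tens_rho_words.
by rewrite !tE (evM (@scalM _) RM (fun a u => scalC a (R u)) RN).
Qed.
Lemma tens_rho_cont : exists N, forall a : ncseries k,
  (forall u, (wt u < N)%N -> a u = 0) -> tens_rho V V' a = 0.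
Proof.
have [N [R [R0 RM RN _ tE]]] := tens_rho_words; exists N => a h.
rewrite tE (evE _ RN _ (leqnn N)) big_seq big1 // => u; rewrite mem_words => /h ->.
by rewrite scal_comp scale0r.
Qed.

Definition wtens : wmod k := WMod tens_rho1 tens_rhoM tens_rho_cont.

Lemma wtens_gen n : rho wtens (wgen k n) = \sum_(i < n.+1) tensf (rho V (wgen k i)) (rho V' (wgen k (n - i))).
Proof.
case: n => [|n]; first by rewrite big_ord_recl big_ord0 addr0 /= tens_rho1 !rho1 tensf1.
have [N [R [R0 RM RN Rg tE]]] := tens_rho_words.
by rewrite -Rg /= tE (ev_mono (@scal1 _) RN).
Qed.
End TensorModule.

Section Constraints.
Variable k : fieldType.
Implicit Types V : wmod k.

Lemma sum_triple (Z : zmodType) (n : nat) (G : nat -> nat -> nat -> Z) :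
  \sum_(i < n.+1) \sum_(j < i.+1) G j (i - j)%N (n - i)%N
  = \sum_(a < n.+1) \sum_(b < (n - a).+1) G a b (n - a - b)%N.
Proof.
transitivity (\sum_(i < n.+1) \sum_(j < n.+1 | (j <= i)%N) G j (i - j)%N (n - i)%N).
  apply: eq_bigr => i _; rewrite (big_ord_widen n.+1 (fun j => G j (i - j)%N (n - i)%N)) ?ltnS //.
  by rewrite -ltnS.
rewrite (exchange_big_dep xpredT) //=; apply: eq_bigr => a _.
rewrite -(big_geq_mkord a n.+1 xpredT (fun i => G a (i - a)%N (n - i)%N)).
have le : (a <= n)%N by rewrite -ltnS.
rewrite -{1}[nat_of_ord a]add0n big_addn subSn // big_mkord; apply: eq_bigr => b _.
by rewrite addnK subnDA subnAC.
Qed.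
End Constraints.


Section WCategory.
Variable k : fieldType.
Implicit Types U V X Y : wmod k.

Lemma wid_mor V a v : (\1%VF : 'End(V)) (rho V a v) = rho V a ((\1%VF : 'End(V)) v).
Proof. by rewrite !id_lfunE. Qed.
Definition wid V : wmor V V := WMor (@wid_mor V).

Lemma wcomp_mor U V X (g : wmor V X) (f : wmor U V) a u :
  (g \o f)%VF (rho U a u) = rho X a ((g \o f)%VF u).
Proof. by rewrite !comp_lfunE !wmorP. Qed.
Definition wcomp U V X (g : wmor V X) (f : wmor U V) : wmor U X := WMor (wcomp_mor g f).

Lemma wtens_pure U V n (u : U) (v : V) :
  rho (wtens U V) (wgen k n) (tpure u v) =
  \sum_(i < n.+1) tpure (rho U (wgen k i) u) (rho V (wgen k (n - i)) v).
Proof. by rewrite wtens_gen sum_lfunE; apply: eq_bigr => i _; rewrite tensf_pure. Qed.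

Lemma wtensm_mor U U' V V' (f : wmor U U') (g : wmor V V') a t :
  tensf f g (rho (wtens U V) a t) = rho (wtens U' V') a (tensf f g t).
Proof.
move: a t; apply: (@wmor_gen k (wtens U V) (wtens U' V') (tensf f g)) => n.
apply: tens_ext => u v; rewrite !comp_lfunE tensf_pure !wtens_pure linear_sum.
by apply: eq_bigr => i _; rewrite /= tensf_pure !wmorP.
Qed.
Definition wtensm U U' V V' (f : wmor U U') (g : wmor V V') :
  wmor (wtens U V) (wtens U' V') := @WMor k (wtens U V) (wtens U' V') (tensf f g) (wtensm_mor f g).

Lemma wassoc_mor U V X a t :
  tassoc U V X (rho (wtens (wtens U V) X) a t) = rho (wtens U (wtens V X)) a (tassoc U V X t).
Proof.
move: a t; apply: (@wmor_gen k (wtens (wtens U V) X) (wtens U (wtens V X)) (tassoc U V X)) => n.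
apply: tens_ext3 => u v x; rewrite !comp_lfunE tassoc_pure (@wtens_pure (wtens U V)) wtens_pure linear_sum.
transitivity (\sum_(i < n.+1) \sum_(j < i.+1)
   (tpure (rho U (wgen k j) u) (tpure (rho V (wgen k (i - j)) v) (rho X (wgen k (n - i)) x)) : tens U (tens V X))).
  apply: eq_bigr => i _; rewrite wtens_pure pure_suml linear_sum /=.
  by apply: eq_bigr => j _; rewrite tassoc_pure.
rewrite (@sum_triple _ n (fun a b c => tpure (rho U (wgen k a) u) (tpure (rho V (wgen k b) v) (rho X (wgen k c) x)) : tens U (tens V X))).
by apply: eq_bigr => i _; rewrite (@wtens_pure V X) pure_sumr.
Qed.
Definition wassoc U V X : wmor (wtens (wtens U V) X) (wtens U (wtens V X)) :=
  @WMor k (wtens (wtens U V) X) (wtens U (wtens V X)) (tassoc U V X) (@wassoc_mor U V X).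

Lemma wcomm_mor U V a t :
  tcomm U V (rho (wtens U V) a t) = rho (wtens V U) a (tcomm U V t).
Proof.
move: a t; apply: (@wmor_gen k (wtens U V) (wtens V U) (tcomm U V)) => n.
apply: tens_ext => u v; rewrite !comp_lfunE tcomm_pure !wtens_pure linear_sum.
rewrite (reindex_inj rev_ord_inj); apply: eq_bigr => i _ /=.
by rewrite /= tcomm_pure subSS subKn // -ltnS.
Qed.
Definition wcomm U V : wmor (wtens U V) (wtens V U) := @WMor k (wtens U V) (wtens V U) (tcomm U V) (@wcomm_mor U V).

Lemma wunit_gen n c : rho (wunit k) (wgen k n) c = if n == 0%N then c else 0.
Proof.
rewrite /= /unit_rho scale_lfunE id_lfunE.
by case: n => [|n] /=; rewrite /monom ?ser_oneE /= ?scale1r ?scale0r.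
Qed.

Lemma wlunit_mor V a t : tlunit V (rho (wtens (wunit k) V) a t) = rho V a (tlunit V t).
Proof.
move: a t; apply: (@wmor_gen k (wtens (wunit k) V) V (tlunit V)) => n.
apply: tens_ext => c v; rewrite !comp_lfunE tlunit_pure wtens_pure linear_sum.
rewrite big_ord_recl big1 => [|i _]; rewrite wunit_gen.
  by rewrite /= addr0 tlunit_pure subn0 linearZ.
by rewrite pure0l linear0.
Qed.
Definition wlunit V : wmor (wtens (wunit k) V) V := @WMor k (wtens (wunit k) V) V (tlunit V) (@wlunit_mor V).

Lemma wrunit_mor V a t : trunit V (rho (wtens V (wunit k)) a t) = rho V a (trunit V t).
Proof.
move: a t; apply: (@wmor_gen k (wtens V (wunit k)) V (trunit V)) => n.
apply: tens_ext => v c; rewrite !comp_lfunE trunit_pure wtens_pure linear_sum.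
rewrite big_ord_recr big1 => [|i _]; rewrite wunit_gen.
  by rewrite subnn /= add0r trunit_pure linearZ.
by rewrite /= subn_eq0 leqNgt ltn_ord pure0r linear0.
Qed.
Definition wrunit V : wmor (wtens V (wunit k)) V := @WMor k (wtens V (wunit k)) V (trunit V) (@wrunit_mor V).
End WCategory.

Record dmod (k : fieldType) := DMod {
  dmod_space :> vectType (ratfun k);
  Phi : dmod_space -> dmod_space;
  Phi_semilinear : forall c x y, Phi (c *: x + y) = sigma c *: Phi x + Phi y;
  Phi_bij : bijective Phi }.

Record dmor (k : fieldType) (M M' : dmod k) := DMor {
  dmor_map :> 'Hom(M, M');
  dmorP : forall x, dmor_map (Phi x) = Phi (dmor_map x) }.

Lemma dmor_eq (k : fieldType) (M M' : dmod k) (f g : dmor M M') :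
  (f = g :> 'Hom(M, M')) -> f = g.
Proof. by case: f g => [f ?] [g ?] /= e; subst g; congr DMor; exact: Prop_irrelevance. Qed.

Section Semi.
Variables (F : fieldType) (tau : {rmorphism F -> F}).
Definition semi (U V : vectType F) (f : U -> V) := forall c x y, f (c *: x + y) = tau c *: f x + f y.

Lemma semi0 (U V : vectType F) (f : U -> V) : semi f -> f 0 = 0.
Proof.
move=> h; have := h 1 0 0; rewrite scaler0 addr0 rmorph1 scale1r => e.
by apply: (addrI (f 0)); rewrite -e addr0.
Qed.
Lemma semiD (U V : vectType F) (f : U -> V) x y : semi f -> f (x + y) = f x + f y.
Proof. by move=> h; have := h 1 x y; rewrite rmorph1 !scale1r. Qed.
Lemma semiZ (U V : vectType F) (f : U -> V) c x : semi f -> f (c *: x) = tau c *: f x.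
Proof. by move=> h; have := h c x 0; rewrite (semi0 h) !addr0. Qed.
Lemma semi_sum (U V : vectType F) (f : U -> V) I r (P : pred I) (g : I -> U) : semi f ->
  f (\sum_(i <- r | P i) g i) = \sum_(i <- r | P i) f (g i).
Proof. by move=> h; apply: (big_morph f) => [x y|]; rewrite ?(semi0 h) ?(semiD _ _ h). Qed.

Lemma semi_ext (U V X : vectType F) (f g : tens U V -> X) : semi f -> semi g ->
  (forall u v, f (tpure u v) = g (tpure u v)) -> f =1 g.
Proof.
move=> hf hg e M; rewrite (pure_sum M) (semi_sum _ _ _ hf) (semi_sum _ _ _ hg); apply: eq_bigr => i _.
rewrite (semi_sum _ _ _ hf) (semi_sum _ _ _ hg); apply: eq_bigr => j _.
by rewrite (semiZ _ _ hf) (semiZ _ _ hg) e.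
Qed.

(* f (x) g for tau-semilinear f and g; see tsemi_pure. *)
Definition tsemi (U U' V V' : vectType F) (f : U -> U') (g : V -> V') (T : tens U V) : tens U' V' :=
  \sum_i \sum_j tau ((T : 'M_(_, _)) i j) *: tpure (f (basis_vec i)) (g (basis_vec j)).

Lemma tsemi_semi (U U' V V' : vectType F) (f : U -> U') (g : V -> V') : semi (tsemi f g).
Proof.
move=> c x y; rewrite /tsemi scaler_sumr -big_split; apply: eq_bigr => i _ /=.
rewrite scaler_sumr -big_split; apply: eq_bigr => j _ /=.
by rewrite !mxE rmorphD rmorphM scalerDl scalerA.
Qed.

Lemma tsemi_pure (U U' V V' : vectType F) (f : U -> U') (g : V -> V') u v :
  semi f -> semi g -> tsemi f g (tpure u v) = tpure (f u) (g v).
Proof.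
move=> hf hg; rewrite -[u in RHS]co_sum -[v in RHS]co_sum (semi_sum _ _ _ hf) (semi_sum _ _ _ hg).
rewrite pure_suml; apply: eq_bigr => i _; rewrite pure_sumr; apply: eq_bigr => j _.
by rewrite (semiZ _ _ hf) (semiZ _ _ hg) pureZl pureZr scalerA mxE rmorphM.
Qed.
End Semi.

Section DCategory.
Variable k : fieldType.
Local Notation K := (ratfun k).
Local Notation sg := (@sigma k : {rmorphism K -> K}).
Implicit Types M N P : dmod k.

Lemma Phi_semi M : semi sg (@Phi k M). Proof. exact: Phi_semilinear. Qed.

Lemma did_mor M x : (\1%VF : 'End(M)) (Phi x) = Phi ((\1%VF : 'End(M)) x).
Proof. by rewrite !id_lfunE. Qed.
Definition did M : dmor M M := DMor (@did_mor M).

Lemma dcomp_mor M N P (g : dmor N P) (f : dmor M N) x :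
  (g \o f)%VF (Phi x) = Phi ((g \o f)%VF x).
Proof. by rewrite !comp_lfunE !dmorP. Qed.
Definition dcomp M N P (g : dmor N P) (f : dmor M N) : dmor M P := DMor (dcomp_mor g f).

Definition dtens_Phi M N : tens M N -> tens M N := tsemi sg (@Phi k M) (@Phi k N).
Lemma dtens_semi M N c (x y : tens M N) :
  dtens_Phi (c *: x + y) = sigma c *: dtens_Phi x + dtens_Phi y.
Proof. exact: (tsemi_semi sg). Qed.

Lemma dtens_bij M N : bijective (@dtens_Phi M N).
Proof.
have [f fK Kf] := Phi_bij M; have [g gK Kg] := Phi_bij N.
pose ti : {rmorphism K -> K} := translate (-1).
have si M' (h : M' -> M') : cancel (@Phi k M') h -> cancel h (@Phi k M') -> semi ti h.
  move=> hK Kh c x y; rewrite -{1}(Kh x) -{1}(Kh y) -{1}[c](translateVK 1).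
  by rewrite -Phi_semilinear hK.
have sf := si _ _ fK Kf; have sg' := si _ _ gK Kg.
have id_semi : semi idfun (idfun : tens M N -> tens M N) by [].
have c1 : semi (idfun : {rmorphism K -> K}) (tsemi ti f g \o @dtens_Phi M N).
  by move=> c x y /=; rewrite dtens_semi (tsemi_semi ti); congr (_ *: _ + _); apply: translateK.
have c2 : semi (idfun : {rmorphism K -> K}) (@dtens_Phi M N \o tsemi ti f g).
  by move=> c x y /=; rewrite (tsemi_semi ti) dtens_semi; congr (_ *: _ + _); apply: translateVK.
exists (tsemi ti f g).
  apply: (semi_ext c1 id_semi) => u v /=.
  by rewrite /dtens_Phi (tsemi_pure _ _ (@Phi_semi M) (@Phi_semi N)) (tsemi_pure _ _ sf sg') fK gK.
apply: (semi_ext c2 id_semi) => u v /=.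
by rewrite (tsemi_pure _ _ sf sg') /dtens_Phi (tsemi_pure _ _ (@Phi_semi M) (@Phi_semi N)) Kf Kg.
Qed.
Definition dtens M N : dmod k := DMod (@dtens_semi M N) (@dtens_bij M N).

Lemma dtens_pure M N (x : M) (y : N) : Phi (tpure x y : dtens M N) = tpure (Phi x) (Phi y).
Proof. exact: (tsemi_pure _ _ (@Phi_semi M) (@Phi_semi N)). Qed.

Lemma semi_lfl (U V X : vectType K) (f : 'Hom(V, X)) (h : U -> V) : semi sg h -> semi sg (f \o h).
Proof. by move=> hh c x y /=; rewrite hh linearP. Qed.
Lemma semi_lfr (U V X : vectType K) (f : 'Hom(U, V)) (h : V -> X) : semi sg h -> semi sg (h \o f).
Proof. by move=> hh c x y /=; rewrite linearP hh. Qed.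

Lemma dmor_pure M N P (f : 'Hom(tens M N, P)) :
  (forall u v, f (@Phi k (dtens M N) (tpure u v)) = Phi (f (tpure u v))) ->
  forall x : dtens M N, f (Phi x) = Phi (f x).
Proof. exact: (semi_ext (semi_lfl f (@Phi_semi (dtens M N))) (semi_lfr f (@Phi_semi P))). Qed.

Lemma dtensm_mor M M' N N' (f : dmor M M') (g : dmor N N') (x : dtens M N) :
  tensf f g (Phi x) = Phi (tensf f g x : dtens M' N').
Proof.
move: x; apply: (@dmor_pure M N (dtens M' N') (tensf f g)) => u v.
by rewrite tensf_pure !dtens_pure tensf_pure !dmorP.
Qed.
Definition dtensm M M' N N' (f : dmor M M') (g : dmor N N') : dmor (dtens M N) (dtens M' N') :=
  @DMor k (dtens M N) (dtens M' N') (tensf f g) (dtensm_mor f g).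

Definition dunit_Phi (x : K^o) : K^o := sigma x.
Lemma dunit_semi c (x y : K^o) : dunit_Phi (c *: x + y) = sigma c *: dunit_Phi x + dunit_Phi y.
Proof. by rewrite /dunit_Phi rmorphD rmorphM. Qed.
Definition dunit : dmod k := DMod dunit_semi (@sigma_bij k).

Lemma semi_ext3 (U V X Y : vectType K) (f g : tens (tens U V) X -> Y) : semi sg f -> semi sg g ->
  (forall u v x, f (tpure (tpure u v) x) = g (tpure (tpure u v) x)) -> f =1 g.
Proof.
move=> hf hg e; apply: (semi_ext hf hg) => t x.
have s h : semi sg h -> semi sg (fun t => h (tpure t x : tens (tens U V) X) : Y).
  by move=> hh c p q; rewrite pureDl pureZl hh.
exact: (semi_ext (s _ hf) (s _ hg)).
Qed.

Lemma dassoc_mor M N P (x : dtens (dtens M N) P) :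
  tassoc M N P (Phi x) = Phi (tassoc M N P x : dtens M (dtens N P)).
Proof.
move: x; apply: (semi_ext3 (semi_lfl (tassoc M N P) (@Phi_semi (dtens (dtens M N) P)))
  (semi_lfr (tassoc M N P) (@Phi_semi (dtens M (dtens N P))))) => u v y.
rewrite -[LHS]/(tassoc M N P (@Phi k (dtens (dtens M N) P) (tpure (tpure u v) y))).
rewrite -[RHS]/(@Phi k (dtens M (dtens N P)) (tassoc M N P (tpure (tpure u v) y))).
by rewrite tassoc_pure (@dtens_pure (dtens M N)) (@dtens_pure M N) (@dtens_pure M (dtens N P)) (@dtens_pure N P) tassoc_pure.
Qed.
Definition dassoc M N P : dmor (dtens (dtens M N) P) (dtens M (dtens N P)) := @DMor k (dtens (dtens M N) P) (dtens M (dtens N P)) (tassoc M N P) (@dassoc_mor M N P).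

Lemma dcomm_mor M N (x : dtens M N) : tcomm M N (Phi x) = Phi (tcomm M N x : dtens N M).
Proof.
move: x; apply: (@dmor_pure M N (dtens N M) (tcomm M N)) => u v.
by rewrite tcomm_pure !dtens_pure tcomm_pure.
Qed.
Definition dcomm M N : dmor (dtens M N) (dtens N M) := @DMor k (dtens M N) (dtens N M) (tcomm M N) (@dcomm_mor M N).

Lemma dlunit_mor M (x : dtens dunit M) : tlunit M (Phi x) = Phi (tlunit M x).
Proof.
move: x; apply: (@dmor_pure dunit M M (tlunit M)) => u v.
by rewrite tlunit_pure (@dtens_pure dunit M) tlunit_pure (semiZ _ _ (@Phi_semi M)).
Qed.
Definition dlunit M : dmor (dtens dunit M) M := @DMor k (dtens dunit M) M (tlunit M) (@dlunit_mor M).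

Lemma drunit_mor M (x : dtens M dunit) : trunit M (Phi x) = Phi (trunit M x).
Proof.
move: x; apply: (@dmor_pure M dunit M (trunit M)) => u v.
by rewrite trunit_pure (@dtens_pure M dunit) trunit_pure (semiZ _ _ (@Phi_semi M)).
Qed.
Definition drunit M : dmor (dtens M dunit) M := @DMor k (dtens M dunit) M (trunit M) (@drunit_mor M).
End DCategory.


Section ScalarExtension.
Variable k : fieldType.
Local Notation K := (ratfun k).

(* k(s) (x) V, as coordinate vectors with respect to the basis of V.
   ext_vec v is 1 (x) v, ext_map f is id (x) f, and ext_sigma is
   sigma (x) id. *)
Definition ext (V : vectType k) : vectType K := 'rV[K]_(\dim {:V}).

Definition ext_vec (V : vectType k) (v : V) : ext V := \row_i ratC (coef i v).

Definition ext_map (V V' : vectType k) (f : 'Hom(V, V')) : 'Hom(ext V, ext V') :=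
  linfun (fun U : ext V => \row_j \sum_i (U : 'rV_ _) 0 i * ratC (coef j (f (basis_vec i))) : ext V').

Definition ext_sigma (V : vectType k) (U : ext V) : ext V := map_mx (@sigma k) (U : 'rV_ _).

Lemma ext_map_linear (V V' : vectType k) (f : 'Hom(V, V')) :
  linear (fun U : ext V => \row_j \sum_i (U : 'rV_ _) 0 i * ratC (coef j (f (basis_vec i))) : ext V').
Proof.
move=> c x y; apply/rowP => j; rewrite !mxE mulr_sumr -big_split; apply: eq_bigr => i _.
by rewrite !mxE mulrDl mulrA.
Qed.

Lemma ext_mapE (V V' : vectType k) (f : 'Hom(V, V')) (U : ext V) :
  ext_map f U = \row_j \sum_i (U : 'rV_ _) 0 i * ratC (coef j (f (basis_vec i))).
Proof.
pose h := HB.pack (fun U : ext V => \row_j \sum_i (U : 'rV_ _) 0 i * ratC (coef j (f (basis_vec i))) : ext V')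
 (GRing.isSemilinear.Build K _ _ _ _ (GRing.semilinear_linear (ext_map_linear f))) : {linear ext V -> ext V'}.
exact: (lfunE h).
Qed.

Lemma ext_map_vec (V V' : vectType k) (f : 'Hom(V, V')) v : ext_map f (ext_vec v) = ext_vec (f v).
Proof.
apply/rowP => j; rewrite ext_mapE !mxE -[v in RHS]co_sum !linear_sum rmorph_sum.
by apply: eq_bigr => i _; rewrite !linearZ /= mxE -rmorphM.
Qed.

Lemma ext_vec_span (V : vectType k) (U : ext V) :
  U = \sum_i (U : 'rV_ _) 0 i *: ext_vec (basis_vec i).
Proof.
apply/rowP => j; rewrite summxE (bigD1 j) //= !mxE co_bv eqxx rmorph1 mulr1 big1 ?addr0 // => i ij.
by rewrite !mxE co_bv eq_sym (negbTE ij) rmorph0 mulr0.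
Qed.

Lemma ext_eq (V : vectType k) (X : vectType K) (f g : 'Hom(ext V, X)) :
  (forall v : V, f (ext_vec v) = g (ext_vec v)) -> f = g.
Proof.
move=> h; apply/lfunP => U; rewrite (ext_vec_span U) !linear_sum; apply: eq_bigr => i _.
by rewrite !linearZ /= h.
Qed.

Lemma ext_map_id (V : vectType k) : ext_map (\1 : 'End(V)) = \1%VF.
Proof. by apply: ext_eq => v; rewrite ext_map_vec !id_lfunE. Qed.
Lemma ext_map_comp (U V X : vectType k) (g : 'Hom(V, X)) (f : 'Hom(U, V)) :
  ext_map (g \o f) = (ext_map g \o ext_map f)%VF.
Proof. by apply: ext_eq => v; rewrite comp_lfunE !ext_map_vec comp_lfunE. Qed.
Lemma ext_map0 (U V : vectType k) : ext_map (0 : 'Hom(U, V)) = 0.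
Proof.
apply: ext_eq => v; rewrite ext_map_vec !zero_lfunE; apply/rowP => j; rewrite !mxE.
by rewrite linear0 rmorph0.
Qed.

Lemma ext_sigma_semi (V : vectType k) c (x y : ext V) :
  ext_sigma (c *: x + y) = sigma c *: ext_sigma x + ext_sigma y.
Proof. by apply/rowP => i; rewrite !mxE rmorphD rmorphM. Qed.

Lemma ext_map_sigma (V V' : vectType k) (f : 'Hom(V, V')) U :
  ext_map f (ext_sigma U) = ext_sigma (ext_map f U).
Proof.
apply/rowP => j; rewrite !ext_mapE !mxE rmorph_sum; apply: eq_bigr => i _.
by rewrite mxE rmorphM; congr (_ * _); apply: (esym (translate_cst 1 _)).
Qed.
End ScalarExtension.

Section DifferenceFunctor.
Variable k : fieldType.
Local Notation K := (ratfun k).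
Implicit Types V : wmod k.

Definition aW : ncseries K := fun u =>
  (1 : ncseries K) u + \sum_(n \in [set n | (0 < n)%N]) ((var_s + 1) ^+ n)^-1 * wgen K n u.

(* The extension of rho : W -> End(V) to series with coefficients in k(s):
   a finite sum, by continuity. *)
Definition ext_rho V (a : ncseries K) : 'End(ext V) :=
  \sum_(u \in [set: word]) a u *: ext_map (rho V (monom k u)).

Lemma aW_nil : aW [::] = 1.
Proof.
rewrite /aW ser_oneE fsbig1 ?addr0 // => -[|n] //= _; by rewrite /monom mulr0.
Qed.
Lemma aW_cons n u : aW (n :: u) = if u is [::] then ((var_s + 1) ^+ n.+1)^-1 else 0.
Proof.
rewrite /aW ser_oneE add0r.
case: u => [|m u].
  rewrite (fsbigE [:: n.+1]) //; last 2 first.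
  - by move=> x /=; rewrite inE => /eqP ->.
  - move=> [|x] //= _; rewrite inE eqSS /monom eqseq_cons andbT eq_sym => /negbTE ->.
    by rewrite mulr0.
  by rewrite big_mkcond big_seq1 ifT ?inE //= /monom eqxx mulr1.
by rewrite fsbig1 // => -[|x] //= _; rewrite /monom eqseq_cons andbF mulr0.
Qed.

(* The inverse of aW, which makes ext_rho V aW invertible. *)
Definition aW_inv : ncseries K := fun u => \prod_(n <- u) - ((var_s + 1) ^+ n.+1)^-1.

Lemma aW_invM : aW * aW_inv = 1.
Proof.
apply: funext => -[|n u]; rewrite -[LHS]/(ser_mul _ _ _) ?ser_mul0 ?ser_mulS aW_nil mul1r.
  by rewrite /aW_inv big_nil.
rewrite {1}/aW_inv big_cons -/(aW_inv u) ser_oneE /=.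
suff -> : ser_mul (dser n aW) aW_inv u = ((var_s + 1) ^+ n.+1)^-1 * aW_inv u.
  by rewrite mulNr addNr.
case: u => [|m u]; first by rewrite ser_mul0 /dser aW_cons.
rewrite ser_mulS {1}/dser aW_cons -[RHS]addr0; congr (_ + _).
rewrite /ser_mul big1 // => i _; by rewrite /dser aW_cons mul0r.
Qed.

Section Act.
Variable V : wmod k.
Let R u := ext_map (rho V (monom k u)).
Lemma extR0 : R [::] = \1%VF. Proof. by rewrite /R rho_mono0 ext_map_id. Qed.
Lemma extRM u v : R (u ++ v) = (R u \o R v)%VF.
Proof. by rewrite /R rho_mono_cat ext_map_comp. Qed.
Lemma ext_rho_ev a : ext_rho V a = ev (@scal K (ext V)) R a.
Proof. by apply: eq_fsbigr => u _; rewrite scal_comp. Qed.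
Lemma extRN : exists N, forall u, (N <= wt u)%N -> R u = 0.
Proof.
have [N h] := rho_bound V; exists N => u hu.
by rewrite /R (rho_mono_bound h) // ext_map0.
Qed.
Lemma ext_rhoM a b : ext_rho V (a * b) = (ext_rho V a \o ext_rho V b)%VF.
Proof.
have [N RN] := extRN; rewrite !ext_rho_ev.
by rewrite (evM (@scalM K _) extRM (fun a u => scalC a (R u)) RN).
Qed.
Lemma ext_rho1 : ext_rho V 1 = \1%VF.
Proof. by have [N RN] := extRN; rewrite !ext_rho_ev (ev1 (@scal1 K _) extR0 RN). Qed.

Lemma ext_rho_aW_ker : lker (ext_rho V aW_inv) == 0%VS.
Proof.
apply/lker0P => x y e; rewrite -[x]id_lfunE -[y]id_lfunE -ext_rho1 -aW_invM ext_rhoM.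
by rewrite !comp_lfunE e.
Qed.
Lemma ext_rhoV : ((ext_rho V aW)^-1 = ext_rho V aW_inv)%VF.
Proof.
have e : (ext_rho V aW \o ext_rho V aW_inv = \1)%VF by rewrite -ext_rhoM aW_invM ext_rho1.
have e2 : (ext_rho V aW_inv \o ext_rho V aW = \1)%VF.
  have h := lker0_compfV ext_rho_aW_ker.
  suff -> : ext_rho V aW = ((ext_rho V aW_inv)^-1)%VF by [].
  by rewrite -[LHS]comp_lfun1r -h comp_lfunA e comp_lfun1l.
have k0 : lker (ext_rho V aW) == 0%VS.
  by apply/lker0P => x y exy; rewrite -[x]id_lfunE -[y]id_lfunE -e2 !comp_lfunE exy.
by rewrite -[LHS]comp_lfun1r -e comp_lfunA lker0_compVf // comp_lfun1l.
Qed.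
Lemma ext_rho_inv_bij : bijective ((ext_rho V aW)^-1)%VF.
Proof.
rewrite ext_rhoV; exists ((ext_rho V aW_inv)^-1)%VF.
  exact: (lker0_lfunK ext_rho_aW_ker).
exact: (lker0_lfunVK ext_rho_aW_ker).
Qed.
End Act.

(* U |-> rho(a_W(s))^-1 sigma(U); ^-1 is the inverse of an endomorphism that
   is invertible by ext_rho_inv_bij. *)
Definition diff_Phi V (U : ext V) : ext V := ((ext_rho V aW)^-1)%VF (ext_sigma U).

Lemma diff_Phi_semi V c (x y : ext V) :
  diff_Phi (c *: x + y) = sigma c *: diff_Phi x + diff_Phi y.
Proof. by rewrite /diff_Phi ext_sigma_semi linearP. Qed.

Lemma diff_Phi_bij V : bijective (@diff_Phi V).
Proof.
apply: (@bij_comp _ _ _ ((ext_rho V aW)^-1)%VF); first exact: ext_rho_inv_bij.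
have [g gK Kg] := @sigma_bij k.
exists (fun U => map_mx g (U : 'rV_ _)) => U; apply/rowP => i; rewrite !mxE //.
Qed.

Definition Dobj V : dmod k := DMod (@diff_Phi_semi V) (@diff_Phi_bij V).

Lemma Dmor_mor V V' (f : wmor V V') (U : Dobj V) :
  ext_map f (Phi U) = Phi (ext_map f U : Dobj V').
Proof.
rewrite /= /diff_Phi !ext_rhoV -ext_map_sigma.
rewrite -!comp_lfunE; congr (fun_of_lfun _ _).
have [N h] := extRN V; have [N' h'] := extRN V'.
rewrite !ext_rho_ev (evE _ h _ (leq_maxl N N')) (evE _ h' _ (leq_maxr N N')).
rewrite comp_suml comp_sumr; apply: eq_bigr => u _.
rewrite !scal_comp -comp_lfunZl -comp_lfunZr -!ext_map_comp; congr (_ *: ext_map _).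
by apply/lfunP => v; rewrite !comp_lfunE wmorP.
Qed.
Definition Dmor V V' (f : wmor V V') : dmor (Dobj V) (Dobj V') :=
  @DMor k (Dobj V) (Dobj V') (ext_map f) (Dmor_mor f).
End DifferenceFunctor.

Section Functors.
Variable k : fieldType.

(* Horizontal vectors are the solutions of U(s + 1) = rho(a_W(s)) U(s). *)
Lemma Phi_fixedP (V : wmod k) (U : Dobj V) :
  Phi U = U <-> ext_sigma U = ext_rho V (aW k) U.
Proof.
have [g gK Kg] := ext_rho_inv_bij V.
rewrite /= /diff_Phi; have e x : ((ext_rho V (aW k))^-1)%VF (ext_rho V (aW k) x) = x.
  rewrite ext_rhoV -comp_lfunE -[in RHS](id_lfunE x); congr (fun_of_lfun _ x).
  have h := lker0_compfV (ext_rho_aW_ker V).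
  have -> : ext_rho V (aW k) = ((ext_rho V (aW_inv k))^-1)%VF.
    by rewrite -[LHS]comp_lfun1r -h comp_lfunA -ext_rhoM aW_invM ext_rho1 comp_lfun1l.
  exact: h.
by split=> [h|->]; [apply: (can_inj gK); rewrite e | apply: e].
Qed.

Record functor_data := FunctorData {
  fobj :> wmod k -> dmod k;
  fmor : forall V V' : wmod k, wmor V V' -> dmor (fobj V) (fobj V') }.
Arguments fmor f {V V'}.

Definition difference_functor : functor_data := FunctorData (@Dmor k).

Definition is_functor (F : functor_data) : Prop :=
  (forall V, fmor F (wid V) = did (F V)) /\
  (forall V V' V'' (g : wmor V' V'') (f : wmor V V'),
     fmor F (wcomp g f) = dcomp (fmor F g) (fmor F f)).

Definition faithful_functor (F : functor_data) : Prop :=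
  forall V V' (f g : wmor V V'), fmor F f = fmor F g -> f = g.

(* 0 -> U -> V -> X -> 0; kernels and images in both categories are those of
   the underlying linear maps. *)
Definition short_exact (K : fieldType) (U V X : vectType K)
    (f : 'Hom(U, V)) (g : 'Hom(V, X)) : Prop :=
  [/\ lker f = 0%VS, limg f = lker g & limg g = fullv].

Definition exact_functor (F : functor_data) : Prop :=
  forall V' V V'' (f : wmor V' V) (g : wmor V V''),
    short_exact f g -> short_exact (fmor F f) (fmor F g).

(* k is the field of constants, so that k acts on the morphisms of
   difference modules through ratC. *)
Definition linear_functor (F : functor_data) : Prop :=
  forall V V' (f g h : wmor V V') (c : k),
    (h = c *: (f : 'Hom(V, V')) + (g : 'Hom(V, V')) :> 'Hom(V, V')) ->
    (fmor F h = ratC c *: (fmor F f : 'Hom(F V, F V')) + (fmor F g : 'Hom(F V, F V'))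
       :> 'Hom(F V, F V')).

Definition dmor_iso (M N : dmod k) (f : dmor M N) : Prop :=
  exists g : dmor N M, dcomp g f = did M /\ dcomp f g = did N.

Section MonoidalStructure.
Variable F : functor_data.
Variable J : forall V V' : wmod k, dmor (dtens (F V) (F V')) (F (wtens V V')).
Variable J0 : dmor (dunit k) (F (wunit k)).

Definition monoidal_iso : Prop :=
  (forall V V', dmor_iso (J V V')) /\ dmor_iso J0.

Definition monoidal_natural : Prop :=
  forall V V' X X' (f : wmor V V') (g : wmor X X'),
    dcomp (J V' X') (dtensm (fmor F f) (fmor F g)) =
    dcomp (fmor F (wtensm f g)) (J V X).

Definition monoidal_assoc : Prop :=
  forall U V X,
    dcomp (fmor F (wassoc U V X)) (dcomp (J (wtens U V) X) (dtensm (J U V) (did (F X)))) =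
    dcomp (J U (wtens V X)) (dcomp (dtensm (did (F U)) (J V X)) (dassoc (F U) (F V) (F X))).

Definition monoidal_comm : Prop :=
  forall U V,
    dcomp (fmor F (wcomm U V)) (J U V) = dcomp (J V U) (dcomm (F U) (F V)).

Definition monoidal_unit : Prop :=
  (forall V, dcomp (fmor F (wlunit V)) (dcomp (J (wunit k) V) (dtensm J0 (did (F V)))) =
             dlunit (F V)) /\
  (forall V, dcomp (fmor F (wrunit V)) (dcomp (J V (wunit k)) (dtensm (did (F V)) J0)) =
             drunit (F V)).
End MonoidalStructure.

(* k-linear, with invertible structure morphisms F V (x) F V' -> F (V (x) V')
   and 1 -> F 1, natural and compatible with the associativity, commutativity
   and unit constraints. *)
Definition tensor_functor (F : functor_data) : Prop :=
  linear_functor F /\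
  exists (J : forall V V' : wmod k, dmor (dtens (F V) (F V')) (F (wtens V V')))
         (J0 : dmor (dunit k) (F (wunit k))),
    [/\ monoidal_iso J J0, monoidal_natural J, monoidal_assoc J,
        monoidal_comm J & monoidal_unit J J0].
End Functors.

(* Main.v *)
From HB Require Import structures.
Require Import Defs.
From mathcomp Require Import all_boot all_order all_algebra.

Set Implicit Arguments.
Unset Strict Implicit.
Unset Printing Implicit Defensive.

Import GRing.Theory.
Local Open Scope ring_scope.

(** On underlying spaces the functor is extension of scalars along the field
    inclusion k -> k(s), and on morphisms it is nothing else.  Hence it is
    k-linear and functorial; it is faithful because the vectors 1 (x) v
    determine v [ext_vec_inj]; it is exact because a short exact sequence of
    vector spaces splits and the splitting, being an equation between linear
    maps, survives any additive functor [ext_map_short_exact]; and it is a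
    tensor functor through
    (1 (x) u) (x) (1 (x) v) |-> 1 (x) (u (x) v), called [ext_tens] below.

    The point with content is that [ext_tens] commutes with the semilinear
    maps rho(a_W)^-1 sigma.  It commutes with sigma because the coordinates of
    u (x) v in the chosen bases are constants [ext_tens_sigma].  For the rest,
    write t = (s + 1)^-1, so that a_W = sum_n t^n w_n with w_0 = 1.  Then
      Delta(a_W) = sum_n t^n sum_(i + j = n) w_i (x) w_j
                 = (sum_i t^i w_i) (x) (sum_j t^j w_j) = a_W (x) a_W,
    that is, a_W is group-like, so on a tensor product it acts as the tensor
    product of its actions on the factors [ext_rho_aW_tens].  In a module all
    w_n of large weight act by zero, so these are finite sums and the
    rearrangement is [sum_convolution].  Likewise the counit sends a_W to 1,
    which handles the unit object [ext_rho_aW_unit].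

    The coherence diagrams compare linear maps over k(s), and such maps agree
    as soon as they agree on tensors of vectors of the form 1 (x) v, where both
    sides are computed by the defining formulas. *)

(** * Linear and exact properties of extension of scalars *)

Section ExtensionOfScalars.
Variable k : fieldType.
Local Notation K := (ratfun k).
Implicit Types U V W : vectType k.

Definition klinear V (X : vectType K) (h : V -> X) : Prop :=
  forall c v w, h (c *: v + w) = ratC c *: h v + h w.

Definition ext_lift_fun V (X : vectType K) (h : V -> X) (x : ext V) : X :=
  \sum_i (x : 'rV_ _) 0 i *: h (basis_vec i).

Lemma ext_lift_linear V (X : vectType K) (h : V -> X) : linear (ext_lift_fun h).
Proof.
move=> c x y; rewrite /ext_lift_fun scaler_sumr -big_split /=.
by apply: eq_bigr => i _; rewrite !mxE scalerDl scalerA.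
Qed.
HB.instance Definition _ V (X : vectType K) (h : V -> X) :=
  GRing.isSemilinear.Build K _ _ _ (ext_lift_fun h)
    (GRing.semilinear_linear (ext_lift_linear h)).

(** The adjunction between extension and restriction of scalars: a k-linear map
    into a k(s)-space has exactly one k(s)-linear extension, characterised by
    [ext_lift_vec]. *)
Definition ext_lift V (X : vectType K) (h : V -> X) : 'Hom(ext V, X) :=
  linfun (ext_lift_fun h).

Lemma klinear0 V (X : vectType K) (h : V -> X) : klinear h -> h 0 = 0.
Proof.
move=> hl; have := hl 1 0 0; rewrite scaler0 addr0 rmorph1 scale1r => e.
by apply: (addrI (h 0)); rewrite -e addr0.
Qed.

Lemma klinear_sum V (X : vectType K) (h : V -> X) (I : finType)
    (a : I -> k) (f : I -> V) :
  klinear h -> h (\sum_i a i *: f i) = \sum_i ratC (a i) *: h (f i).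
Proof.
move=> hl; apply: (big_rec2 (fun x y => h x = y)); first exact: klinear0.
by move=> i y1 y2 _ <-; rewrite hl.
Qed.

Lemma ext_lift_vec V (X : vectType K) (h : V -> X) v :
  klinear h -> ext_lift h (ext_vec v) = h v.
Proof.
move=> hl; rewrite lfunE /= /ext_lift_fun -[v in RHS]co_sum klinear_sum //.
by apply: eq_bigr => i _; rewrite mxE.
Qed.

Lemma ext_vec_klinear V : klinear (@ext_vec k V).
Proof. by move=> c v w; apply/rowP => i; rewrite !mxE linearP rmorphD rmorphM. Qed.

Lemma ext_vec_inj V : injective (@ext_vec k V).
Proof.
move=> v w /rowP e; apply: co_inj => i; have := e i; rewrite !mxE.
exact: fmorph_inj.
Qed.

Lemma ext_map_lincomb V W (f g : 'Hom(V, W)) c :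
  ext_map (c *: f + g) = ratC c *: ext_map f + ext_map g.
Proof.
apply: ext_eq => v.
by rewrite add_lfunE scale_lfunE !ext_map_vec add_lfunE scale_lfunE ext_vec_klinear.
Qed.

Lemma ext_map_inj V W : injective (@ext_map k V W).
Proof.
move=> f g e; apply/lfunP => v; apply: ext_vec_inj.
by rewrite -!ext_map_vec e.
Qed.

(** Each linear map g has a partial inverse g^-1, which provides a section of a
    surjection g and a map r with f r + g^-1 g = 1.  Applying [ext_map] to
    this equation gives ker (id (x) g) within im (id (x) f). *)
Lemma ext_map_short_exact U V W (f : 'Hom(U, V)) (g : 'Hom(V, W)) :
  short_exact f g -> short_exact (ext_map f) (ext_map g).
Proof.
case=> kf fg ig.
have ff : (f^-1 \o f = \1)%VF by apply: lker0_compVf; rewrite kf.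
have gg : (g \o g^-1 = \1)%VF.
  by apply/lfunP => w; rewrite comp_lfunE limg_lfunVK ?ig ?memvf // id_lfunE.
have gf : (g \o f = 0)%VF.
  apply/lfunP => u; rewrite comp_lfunE zero_lfunE; apply/eqP.
  by rewrite -memv_ker -fg memv_img ?memvf.
pose r : 'Hom(V, U) := (f^-1 \o (\1%VF - (g^-1 \o g)%VF))%VF.
(* f f^-1 fixes limg f = lker g, where 1 - g^-1 g takes its values. *)
have split1 : (f \o r)%VF + (g^-1 \o g)%VF = \1%VF.
  apply/lfunP => v; rewrite add_lfunE !comp_lfunE limg_lfunVK.
    by rewrite !add_lfunE opp_lfunE comp_lfunE subrK.
  rewrite fg memv_ker; apply/eqP; rewrite add_lfunE opp_lfunE linearB /= id_lfunE.
  by rewrite -!comp_lfunE comp_lfunA gg comp_lfun1l subrr.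
have ext_split1 : (ext_map f \o ext_map r)%VF + (ext_map g^-1 \o ext_map g)%VF = \1%VF.
  have := ext_map_lincomb (f \o r)%VF (g^-1 \o g)%VF 1.
  by rewrite scale1r split1 ext_map_id rmorph1 scale1r !ext_map_comp => <-.
split.
- apply/eqP/lker0P => x y e; rewrite -[x]id_lfunE -[y]id_lfunE -ext_map_id -ff.
  by rewrite ext_map_comp !comp_lfunE e.
- apply: subv_anti; apply/andP; split; apply/subvP => x.
    case/memv_imgP => u _ ->; rewrite memv_ker -comp_lfunE -ext_map_comp gf.
    by rewrite ext_map0 zero_lfunE.
  rewrite memv_ker => /eqP gx; rewrite -[x]id_lfunE -ext_split1 add_lfunE !comp_lfunE.
  by rewrite gx linear0 addr0 memv_img ?memvf.
- apply: subv_anti; rewrite subvf; apply/subvP => x _.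
  by rewrite -[x]id_lfunE -ext_map_id -gg ext_map_comp comp_lfunE memv_img ?memvf.
Qed.

(** * Compatibility of extension of scalars with tensor products *)

(** The vectors 1 (x) v span over k(s), so their pure tensors do too. *)
Lemma tens_ext_vec_eq U V (X : vectType K) (f g : 'Hom(tens (ext U) (ext V), X)) :
  (forall u v, f (tpure (ext_vec u) (ext_vec v)) = g (tpure (ext_vec u) (ext_vec v))) ->
  f = g.
Proof.
move=> h; apply: tens_ext => x y; rewrite (ext_vec_span x) (ext_vec_span y).
rewrite pure_suml !linear_sum; apply: eq_bigr => i _ /=.
rewrite pure_sumr !linear_sum; apply: eq_bigr => j _ /=.
by rewrite pureZl pureZr !linearZ /= h.
Qed.

(** A general element of U (x) V is a k-combination of pure tensors, and
    v |-> 1 (x) v is k-linear. *)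
Lemma ext_vec_tens_eq U V (X : vectType K) (f g : 'Hom(ext (tens U V), X)) :
  (forall u v, f (ext_vec (tpure u v)) = g (ext_vec (tpure u v))) -> f = g.
Proof.
move=> h; apply: ext_eq => t.
have e (f' : 'Hom(ext (tens U V), X)) : f' (ext_vec t) = \sum_p
    ratC ((t : 'M_(_, _)) p.1 p.2) *: f' (ext_vec (tpure (basis_vec p.1) (basis_vec p.2))).
  have fk : klinear (fun s : tens U V => f' (ext_vec s)).
    by move=> c v w; rewrite ext_vec_klinear linearP.
  rewrite -(klinear_sum (fun p => (t : 'M_(_, _)) p.1 p.2)
    (fun p => tpure (basis_vec p.1) (basis_vec p.2)) fk).
  by congr (f' (ext_vec _)); rewrite [LHS]pure_sum pair_bigA.
by rewrite !e; apply: eq_bigr => p _; rewrite h.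
Qed.

Lemma tens_ext_vec_eq3 U V W (X : vectType K)
    (f g : 'Hom(tens (tens (ext U) (ext V)) (ext W), X)) :
  (forall u v w, f (tpure (tpure (ext_vec u) (ext_vec v)) (ext_vec w))
               = g (tpure (tpure (ext_vec u) (ext_vec v)) (ext_vec w))) ->
  f = g.
Proof.
move=> h; apply: tens_ext3 => x y z.
rewrite (ext_vec_span x) (ext_vec_span y) (ext_vec_span z).
rewrite pure_suml pure_suml !linear_sum; apply: eq_bigr => i _ /=.
rewrite pure_sumr !linear_sum; apply: eq_bigr => l _ /=.
rewrite pure_sumr pure_suml !linear_sum; apply: eq_bigr => j _ /=.
by rewrite !(pureZl, pureZr) !linearZ /= h.
Qed.

Lemma unit_tens_ext_vec_eq V (X : vectType K) (f g : 'Hom(tens K^o (ext V), X)) :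
  (forall v, f (tpure (1 : K^o) (ext_vec v)) = g (tpure (1 : K^o) (ext_vec v))) -> f = g.
Proof.
move=> h; apply: tens_ext => c y; rewrite (ext_vec_span y) -[c]mulr1.
rewrite pure_sumr !linear_sum; apply: eq_bigr => i _ /=.
by rewrite (@pureZl K K^o _ c) (@pureZr K K^o) !linearZ /= h.
Qed.

Lemma tens_unit_ext_vec_eq V (X : vectType K) (f g : 'Hom(tens (ext V) K^o, X)) :
  (forall v, f (tpure (ext_vec v) (1 : K^o)) = g (tpure (ext_vec v) (1 : K^o))) -> f = g.
Proof.
move=> h; apply: tens_ext => x c; rewrite (ext_vec_span x) -[c]mulr1.
rewrite pure_suml !linear_sum; apply: eq_bigr => i _ /=.
by rewrite (@pureZr K _ K^o c) (@pureZl K _ K^o) !linearZ /= h.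
Qed.

(** The canonical map (k(s) (x) U) (x) (k(s) (x) V) -> k(s) (x) (U (x) V),
    characterised by [ext_tens_vec]; it supplies the tensor structure of the
    functor. *)
Definition ext_tens U V : 'Hom(tens (ext U) (ext V), ext (tens U V)) :=
  tlift (fun x y => ext_lift (fun u => ext_lift (fun v => ext_vec (tpure u v)) y) x).

Lemma ext_tens_vec U V (u : U) (v : V) :
  ext_tens U V (tpure (ext_vec u) (ext_vec v)) = ext_vec (tpure u v).
Proof.
have hr (u' : U) : klinear (fun v' : V => ext_vec (tpure u' v')).
  by move=> c p q; rewrite pureDr pureZr ext_vec_klinear.
rewrite /ext_tens tlift_pure; last first.
  split=> [y|x] c p q; first by rewrite linearP.
  rewrite !lfunE /= /ext_lift_fun scaler_sumr -big_split; apply: eq_bigr => i _ /=.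
  by rewrite linearP scalerDr !scalerA mulrC.
rewrite ext_lift_vec ?ext_lift_vec // => c p q.
rewrite !lfunE /= /ext_lift_fun scaler_sumr -big_split; apply: eq_bigr => i _ /=.
by rewrite pureDl pureZl ext_vec_klinear scalerDr !scalerA mulrC.
Qed.

Lemma ext_tens_pure U V (x : ext U) (y : ext V) :
  ext_tens U V (tpure x y) = \sum_i \sum_j
    ((x : 'rV_ _) 0 i * (y : 'rV_ _) 0 j) *: ext_vec (tpure (basis_vec i) (basis_vec j)).
Proof.
rewrite {1}(ext_vec_span x) {1}(ext_vec_span y).
rewrite pure_suml !linear_sum; apply: eq_bigr => i _ /=.
rewrite pure_sumr !linear_sum; apply: eq_bigr => j _ /=.
by rewrite pureZl pureZr scalerA linearZ /= ext_tens_vec.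
Qed.

(** By [ext_tens_pure] the matrix of [ext_tens] consists of coordinates of pure
    tensors over k, which sigma fixes. *)
Lemma ext_tens_sigma U V (x : ext U) (y : ext V) :
  ext_tens U V (tpure (ext_sigma x) (ext_sigma y)) = ext_sigma (ext_tens U V (tpure x y)).
Proof.
apply/rowP => l; rewrite !ext_tens_pure mxE !summxE rmorph_sum; apply: eq_bigr => i _ /=.
rewrite !summxE rmorph_sum; apply: eq_bigr => j _ /=.
rewrite !mxE !rmorphM; congr (_ * _); exact: (esym (translate_cst 1 _)).
Qed.

Definition ext_tens_inv U V : 'Hom(ext (tens U V), tens (ext U) (ext V)) :=
  ext_lift (fun t : tens U V => \sum_i \sum_j
    ratC ((t : 'M_(_, _)) i j) *: tpure (ext_vec (basis_vec i)) (ext_vec (basis_vec j))).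

Lemma ext_tens_inv_vec U V (u : U) (v : V) :
  ext_tens_inv U V (ext_vec (tpure u v)) = tpure (ext_vec u) (ext_vec v).
Proof.
rewrite ext_lift_vec => [|c p q]; last first.
  rewrite scaler_sumr -big_split; apply: eq_bigr => i _ /=.
  rewrite scaler_sumr -big_split; apply: eq_bigr => j _ /=.
  by rewrite !mxE rmorphD rmorphM scalerDl scalerA.
rewrite -[u in RHS]co_sum -[v in RHS]co_sum !(klinear_sum _ _ (@ext_vec_klinear _)).
rewrite pure_suml; apply: eq_bigr => i _; rewrite pure_sumr; apply: eq_bigr => j _.
by rewrite mxE pureZl pureZr scalerA rmorphM.
Qed.

Lemma ext_tensK U V : (ext_tens_inv U V \o ext_tens U V = \1)%VF.
Proof.
by apply: tens_ext_vec_eq => u v; rewrite comp_lfunE ext_tens_vec ext_tens_inv_vec id_lfunE.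
Qed.

Lemma ext_tensVK U V : (ext_tens U V \o ext_tens_inv U V = \1)%VF.
Proof.
by apply: ext_vec_tens_eq => u v; rewrite comp_lfunE ext_tens_inv_vec ext_tens_vec id_lfunE.
Qed.

Lemma ext_tens_natural U U' V V' (f : 'Hom(U, U')) (g : 'Hom(V, V')) :
  (ext_tens U' V' \o tensf (ext_map f) (ext_map g)
   = ext_map (tensf f g) \o ext_tens U V)%VF.
Proof.
apply: tens_ext_vec_eq => u v.
by rewrite !comp_lfunE tensf_pure !ext_map_vec !ext_tens_vec ext_map_vec tensf_pure.
Qed.

(** The canonical map k(s) -> k(s) (x) k. *)
Definition ext_unit_fun (c : (ratfun k)^o) : ext k^o := c *: ext_vec (1 : k^o).
Lemma ext_unit_linear : linear ext_unit_fun.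
Proof. by move=> c x y; rewrite /ext_unit_fun scalerDl scalerA. Qed.
HB.instance Definition _ := GRing.isSemilinear.Build K _ _ _ ext_unit_fun
  (GRing.semilinear_linear ext_unit_linear).

Definition ext_unit : 'Hom((ratfun k)^o, ext k^o) := linfun ext_unit_fun.

Lemma ext_unitE c : ext_unit c = c *: ext_vec (1 : k^o).
Proof. by rewrite lfunE. Qed.

Definition ext_unit_inv : 'Hom(ext k^o, (ratfun k)^o) :=
  ext_lift (fun c : k^o => ratC c : (ratfun k)^o).

Lemma ext_unit_inv_vec c : ext_unit_inv (ext_vec c) = ratC c.
Proof. by rewrite ext_lift_vec // => a v w; rewrite rmorphD rmorphM. Qed.

Lemma ext_unitK : (ext_unit_inv \o ext_unit = \1)%VF.
Proof.
apply/lfunP => c; rewrite comp_lfunE ext_unitE linearZ /= ext_unit_inv_vec.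
by rewrite rmorph1 id_lfunE /GRing.scale /= mulr1.
Qed.

Lemma ext_unitVK : (ext_unit \o ext_unit_inv = \1)%VF.
Proof.
apply: ext_eq => c; rewrite comp_lfunE ext_unit_inv_vec ext_unitE id_lfunE.
have := ext_vec_klinear c (1 : k^o) 0.
by rewrite (klinear0 (@ext_vec_klinear _)) !addr0 => <-; congr ext_vec; apply: mulr1.
Qed.

End ExtensionOfScalars.

(** * The coproduct of the coefficient series *)

(** The Cauchy product of two finite sums, truncated at total degree M: the
    square [0, M)^2 only adds pairs of total degree at least M. *)
Lemma sum_convolution (Z : zmodType) (M : nat) (G : nat -> nat -> Z) :
  (forall i j, (M <= i + j)%N -> G i j = 0) ->
  \sum_(n < M) \sum_(i < n.+1) G i (n - i)%N = \sum_(i < M) \sum_(j < M) G i j.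
Proof.
move=> G0.
transitivity (\sum_(n < M) \sum_(i < M | (i <= n)%N) G i (n - i)%N).
  by apply: eq_bigr => n _; rewrite (big_ord_widen M (fun i => G i (n - i)%N)).
rewrite (exchange_big_dep xpredT) //=; apply: eq_bigr => i _.
rewrite -(big_geq_mkord i M xpredT (fun n => G i (n - i)%N)) -{1}[nat_of_ord i]add0n.
rewrite big_addn big_mkord (big_ord_widen M (fun j => G i (j + i - i)%N)) ?leq_subr //.
rewrite big_mkcond; apply: eq_bigr => j _; rewrite addnK.
by case: ltnP => // h; rewrite G0 // -leq_subLR.
Qed.

Section GroupLike.
Variable k : fieldType.
Local Notation K := (ratfun k).
Implicit Types V : wmod k.

Definition aW_coef (n : nat) : K := ((var_s + 1) ^+ n)^-1.

Lemma aW_coefD i j : aW_coef (i + j) = aW_coef i * aW_coef j.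
Proof. by rewrite /aW_coef exprD invfM. Qed.

(** The words with nonzero coefficient in a_W are the empty one, which stands for
    w_0, and the one-letter words; the sum stops at any M beyond the weight from
    which the module vanishes.  The freedom in M lets modules with different
    bounds share one range of summation. *)
Lemma ext_rho_aW V : exists N, (forall n, (N <= n)%N -> rho V (wgen k n) = 0) /\
  forall M, (N <= M)%N ->
    ext_rho V (aW k) = \sum_(n < M) aW_coef n *: ext_map (rho V (wgen k n)).
Proof.
have [N /(rho_mono_bound (V := V)) h] := rho_bound V.
(* Letters are shifted: the word of w_(m + 1) is [:: m]. *)
pose gw n : word := if n is m.+1 then [:: m] else [::].
have gwE n : wgen k n = monom k (gw n) by case: n.
have wt_gw n : wt (gw n) = n by case: n => [|n]; rewrite ?wt_cons wt_nil ?addn0.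
have aW_gw n : aW k (gw n) = aW_coef n.
  by case: n => [|n]; rewrite ?aW_nil ?aW_cons /aW_coef ?invr1.
exists N; split=> [n hn|M NM]; first by rewrite gwE h ?wt_gw.
rewrite /ext_rho (@fsum_seq _ _ [seq gw n | n <- iota 0 M]).
- rewrite big_map -[M in iota 0 M]subn0 -/(index_iota 0 M) big_mkord.
  by apply: eq_bigr => n _; rewrite aW_gw gwE.
- by rewrite map_inj_uniq ?iota_uniq // => m n /(congr1 wt); rewrite !wt_gw.
move=> u; have [M_u _|u_M uL] := leqP M (wt u).
  by rewrite h ?ext_map0 ?scaler0 // (leq_trans NM).
suff -> : aW k u = 0 by rewrite scale0r.
case: u u_M uL => [|n [|m u]] u_M uL; last by rewrite aW_cons.
  case/negP: uL; apply/mapP; exists 0%N => //.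
  by move: u_M; rewrite wt_nil mem_iota.
case/negP: uL; apply/mapP; exists n.+1 => //.
by move: u_M; rewrite wt_cons wt_nil addn0 mem_iota.
Qed.

(** The series a_W is group-like: (s + 1)^-n is multiplicative in n, and w_n acts
    on V (x) V' by the sum of the w_i (x) w_(n - i). *)
Lemma ext_rho_aW_tens V V' :
  (ext_tens V V' \o tensf (ext_rho V (aW k)) (ext_rho V' (aW k))
   = ext_rho (wtens V V') (aW k) \o ext_tens V V')%VF.
Proof.
have [N [w0 VE]] := ext_rho_aW V; have [N' [w0' V'E]] := ext_rho_aW V'.
have [N'' [_ TE]] := ext_rho_aW (wtens V V').
(* Beyond total degree N + N' one of the two factors vanishes; N'' is the bound
   for the module V (x) V' itself. *)
pose M := (N + N' + N'')%N.
apply: tens_ext_vec_eq => u v; rewrite !comp_lfunE tensf_pure ext_tens_vec.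
rewrite (VE M) ?(V'E M) ?(TE M) /M ?leq_addl -?addnA ?leq_addr //; last first.
  by rewrite addnCA leq_addr.
rewrite addnA -/M !sum_lfunE pure_suml linear_sum.
pose G i j := aW_coef (i + j) *: ext_vec (tpure (rho V (wgen k i) u) (rho V' (wgen k j) v)).
have G0 i j : (M <= i + j)%N -> G i j = 0.
  move=> hM; rewrite /G; have [lN|lN] := leqP N i.
    by rewrite w0 // zero_lfunE pure0l (klinear0 (@ext_vec_klinear _ _)) scaler0.
  rewrite w0' ?zero_lfunE ?pure0r ?(klinear0 (@ext_vec_klinear _ _)) ?scaler0 //.
  rewrite -(leq_add2l i); apply: leq_trans hM; rewrite /M -addnA leq_add ?leq_addr //.
  exact: ltnW.
transitivity (\sum_(i < M) \sum_(j < M) G i j).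
  apply: eq_bigr => i _; rewrite pure_sumr linear_sum; apply: eq_bigr => j _ /=.
  rewrite !scale_lfunE !ext_map_vec pureZl pureZr !linearZ /= ext_tens_vec.
  by rewrite scalerA /G aW_coefD.
rewrite -sum_convolution //; apply: eq_bigr => n _.
rewrite scale_lfunE ext_map_vec wtens_pure.
under [in RHS]eq_bigr do rewrite -[tpure _ _]scale1r.
rewrite (klinear_sum _ _ (@ext_vec_klinear _ _)) scaler_sumr.
apply: eq_bigr => i _; rewrite rmorph1 scale1r /G subnKC //.
by rewrite -ltnS.
Qed.

Lemma ext_rho_aW_unit : ext_rho (wunit k) (aW k) = \1%VF.
Proof.
have [N [_ VE]] := ext_rho_aW (wunit k).
rewrite (VE N.+1) // big_ord_recl big1 => [|i _].
  by rewrite rho1 ext_map_id /aW_coef expr0 invr1 scale1r addr0.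
suff -> : rho (wunit k) (wgen k (lift ord0 i)) = 0 by rewrite ext_map0 scaler0.
by apply/lfunP => c; rewrite wunit_gen zero_lfunE.
Qed.

Lemma ext_rho_aWVK V x : ext_rho V (aW k) ((ext_rho V (aW k))^-1%VF x) = x.
Proof. by rewrite ext_rhoV -comp_lfunE -ext_rhoM aW_invM ext_rho1 id_lfunE. Qed.

Lemma ext_rho_aW_inj V : injective (ext_rho V (aW k)).
Proof. exact: bij_inj (bij_can_bij (ext_rho_inv_bij V) (@ext_rho_aWVK V)). Qed.

(** Multiplication by a_W is injective, so the semilinear map is pinned down by
    rho(a_W) (Phi x) = sigma x; this avoids computing inverses on tensor
    products. *)
Lemma ext_rho_aW_Phi V (x : Dobj V) : ext_rho V (aW k) (Phi x) = ext_sigma x.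
Proof. exact: ext_rho_aWVK. Qed.

End GroupLike.

(** * The tensor functor *)

Section Monoidal.
Variable k : fieldType.
Implicit Types (V : wmod k) (M N : dmod k).

(** After multiplication by rho(a_W) both sides become sigma of the image of
    u (x) v, by [ext_rho_aW_tens] on the left. *)
Lemma ext_tens_mor V V' (x : dtens (Dobj V) (Dobj V')) :
  ext_tens V V' (Phi x) = Phi (ext_tens V V' x : Dobj (wtens V V')).
Proof.
move: x; apply: (@dmor_pure k (Dobj V) (Dobj V') (Dobj (wtens V V')) (ext_tens V V')) => u v.
rewrite dtens_pure; apply: (@ext_rho_aW_inj k (wtens V V')).
rewrite (@ext_rho_aW_Phi k (wtens V V')) -ext_tens_sigma -comp_lfunE -ext_rho_aW_tens.
by rewrite comp_lfunE tensf_pure !ext_rho_aW_Phi.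
Qed.

Definition Dtens V V' : dmor (dtens (Dobj V) (Dobj V')) (Dobj (wtens V V')) :=
  @DMor k (dtens (Dobj V) (Dobj V')) (Dobj (wtens V V')) (ext_tens V V') (@ext_tens_mor V V').

Lemma ext_unit_mor (c : dunit k) : ext_unit k (Phi c) = Phi (ext_unit k c : Dobj (wunit k)).
Proof.
apply: (@ext_rho_aW_inj k (wunit k)).
rewrite (@ext_rho_aW_Phi k (wunit k)) ext_rho_aW_unit id_lfunE !ext_unitE.
apply/rowP => i; rewrite !mxE rmorphM; congr (_ * _); exact: (esym (translate_cst 1 _)).
Qed.

Definition Dunit : dmor (dunit k) (Dobj (wunit k)) :=
  @DMor k (dunit k) (Dobj (wunit k)) (ext_unit k) ext_unit_mor.

Lemma dmor_iso_inv M N (f : dmor M N) (g : 'Hom(N, M)) :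
  (g \o f = \1)%VF -> (f \o g = \1)%VF -> dmor_iso f.
Proof.
move=> gf fg.
have gP x : g (Phi x) = Phi (g x).
  have {1}-> : x = f (g x) by rewrite -comp_lfunE fg id_lfunE.
  by rewrite -dmorP -comp_lfunE gf id_lfunE.
by exists (DMor gP); split; apply: dmor_eq.
Qed.

Lemma difference_is_functor : is_functor (difference_functor k).
Proof.
by split=> [V|V V' V'' g f]; apply: dmor_eq; [exact: ext_map_id | exact: ext_map_comp].
Qed.

Lemma difference_exact : exact_functor (difference_functor k).
Proof. by move=> V' V V'' f g; apply: ext_map_short_exact. Qed.

Lemma difference_faithful : faithful_functor (difference_functor k).
Proof. by move=> V V' f g [e]; apply: wmor_eq; apply: ext_map_inj. Qed.

Lemma difference_linear : linear_functor (difference_functor k).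
Proof. by move=> V V' f g h c /= ->; apply: ext_map_lincomb. Qed.

Lemma difference_tensor : tensor_functor (difference_functor k).
Proof.
split; first exact: difference_linear.
exists Dtens, Dunit; split.
- split=> [V V'|].
    refine (@dmor_iso_inv _ _ (Dtens V V') (ext_tens_inv V V') _ _).
      exact: ext_tensK.
    exact: ext_tensVK.
  refine (@dmor_iso_inv _ _ Dunit (ext_unit_inv k) _ _).
    exact: ext_unitK.
  exact: ext_unitVK.
- by move=> V V' X X' f g; apply: dmor_eq; apply: ext_tens_natural.
- move=> U V X; apply: dmor_eq; apply: tens_ext_vec_eq3 => u v x.
  rewrite /= !comp_lfunE !tensf_pure tassoc_pure !id_lfunE tensf_pure !id_lfunE.
  by rewrite !ext_tens_vec ext_map_vec tassoc_pure.
- move=> U V; apply: dmor_eq; apply: tens_ext_vec_eq => u v.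
  by rewrite /= !comp_lfunE ext_tens_vec ext_map_vec !tcomm_pure ext_tens_vec.
- split=> V; apply: dmor_eq.
    apply: unit_tens_ext_vec_eq => v.
    rewrite /= !comp_lfunE tensf_pure id_lfunE ext_unitE scale1r.
    by rewrite ext_tens_vec ext_map_vec !tlunit_pure !scale1r.
  apply: tens_unit_ext_vec_eq => v.
  rewrite /= !comp_lfunE tensf_pure id_lfunE ext_unitE scale1r.
  by rewrite ext_tens_vec ext_map_vec !trunit_pure !scale1r.
Qed.

End Monoidal.

Theorem proposition7 (k : closedFieldType) (char0 : [pchar k]%R =i pred0) :
  is_functor (difference_functor k) /\
  exact_functor (difference_functor k) /\
  faithful_functor (difference_functor k) /\
  tensor_functor (difference_functor k).
Proof.
split; first exact: difference_is_functor.
split; first exact: difference_exact.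
split; first exact: difference_faithful.
exact: difference_tensor.
Qed.
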